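(* Let $q\ge 0$ and $s\ge 3$ be integers, and let $G=K_1\vee (C_s\cup qK_2)$. If $G$ has at least $16$ vertices (i.e. $s+2q+1\ge 16$), then $G$ is determined by its signless Laplacian spectrum: every simple graph whose signless Laplacian spectrum equals that of $G$ is isomorphic to $G$.
   Context: All graphs are finite, simple and undirected unless stated otherwise. $K_n$, $C_n$ denote the complete graph and the cycle on $n$ vertices; $G\cup H$ is the disjoint union; $qG$ is the disjoint union of $q$ copies of $G$ ($0K_2$ is the empty graph); $G\vee H$ is the join, obtained from $G\cup H$ by adding all edges between $V(G)$ and $V(H)$. The signless Laplacian of $G$ is $Q(G)=A(G)+D(G)$, where $A(G)$ is the adjacency matrix and $D(G)$ the diagonal matrix of vertex degrees; its eigenvalues (with multiplicities) form the signless Laplacian spectrum ($Q$-spectrum). A graph is DQS (determined by its signless Laplacian spectrum) if no non-isomorphic graph has the same $Q$-spectrum. *)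

(* Defs.v *)
From HB Require Import structures.
From mathcomp Require Import all_boot all_order all_algebra all_field.
Set Implicit Arguments. Unset Strict Implicit. Unset Printing Implicit Defensive.
Import Order.TTheory GRing.Theory Num.Theory.
Local Open Scope ring_scope.

Definition simple_graph (T : finType) (e : rel T) : Prop :=
  symmetric e /\ irreflexive e.

Definition K1_rel : rel unit := fun _ _ => false.
Definition K2_rel : rel bool := fun a b => a != b.
Definition cycle_rel (s : nat) : rel 'I_s :=
  fun i j => (nat_of_ord j == i.+1 %% s)%N || (nat_of_ord i == j.+1 %% s)%N.
Definition copies_rel (I T : finType) (e : rel T) : rel (I * T) :=
  fun x y => (x.1 == y.1) && e x.2 y.2.
Definition union_rel (T1 T2 : finType) (e1 : rel T1) (e2 : rel T2)
  : rel (T1 + T2) :=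
  fun x y => match x, y with
             | inl a, inl b => e1 a b
             | inr a, inr b => e2 a b
             | _, _ => false
             end.
Definition join_rel (T1 T2 : finType) (e1 : rel T1) (e2 : rel T2)
  : rel (T1 + T2) :=
  fun x y => match x, y with
             | inl a, inl b => e1 a b
             | inr a, inr b => e2 a b
             | _, _ => true
             end.

Definition Gvert (q s : nat) : finType := (unit + (ordinal s + (ordinal q * bool)%type)%type)%type.
Definition Grel (q s : nat) : rel (Gvert q s) :=
  join_rel K1_rel (union_rel (@cycle_rel s) (@copies_rel (ordinal q) _ K2_rel)).

Definition deg (T : finType) (e : rel T) (x : T) : nat := #|[pred y | e x y]|.

Definition Qmx (T : finType) (e : rel T) : 'M[algC]_#|T| :=
  \matrix_(i, j) ((e (enum_val i) (enum_val j))%:R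
                  + (i == j)%:R * (deg e (enum_val i))%:R).

(* Equal Q-spectra (eigenvalues with multiplicities) = equal characteristic
   polynomials of Q over the algebraically closed field algC. *)
Definition Q_cospectral (T1 T2 : finType) (e1 : rel T1) (e2 : rel T2) : Prop :=
  char_poly (Qmx e1) = char_poly (Qmx e2).

Definition isomorphic (T1 T2 : finType) (e1 : rel T1) (e2 : rel T2) : Prop :=
  exists f : T1 -> T2, bijective f /\ forall x y, e2 (f x) (f y) = e1 x y.

Arguments Grel q s : clear implicits.
Arguments Gvert q s : clear implicits.

(* Main.v *)
Require Import Defs.
From HB Require Import structures.
From mathcomp Require Import all_boot all_order all_fingroup all_algebra all_field.
From mathcomp Require Import spectral ring zify.

(** Cospectral symmetric matrices are unitarily similar, so a graph H cospectral
    with G = K_1 v (C_s u qK_2) inherits every unitarily invariant property of Q(G).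
    Three of them are used: Q >= 1; Q < 5 on some hyperplane; and 1 and
    3 + w + 1/w (w a primitive s-th root of unity) are eigenvalues of multiplicity
    at least q (q + 1 if s is even) and 2.

    Q >= 1 forces all degrees of H to be at least 2. The second property, tested
    on vectors a 1_P + b 1_R with P and R disjoint, bounds all degrees but the
    largest by 5 and lets at most one of those be 5. Since the sums of d and d^2
    are those of G, the largest degree is n - 1 and the other ones are 2 or 3.
    Deleting the centre leaves q paths and, by the second property again, at most
    one cycle.

    An eigenfunction for 3 + w + 1/w vanishing at the centre is a multiple of
    w^(i+1) - w^(-i) along a path with k vertices, and is zero there unless
    w^(2k) = 1; it is zero on a cycle with a vertices unless w^a = 1. So if no
    cycle has s vertices, s divides 2k for some path. If s is odd then k = s, and
    this odd path makes the multiplicity of 1 smaller than q. If s is even the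
    multiplicity of 1 forces an even cycle, hence 2k = s for one or two paths, and
    the eigenvalue 3 + w + 1/w has multiplicity at most 1. *)

Set Implicit Arguments. Unset Strict Implicit. Unset Printing Implicit Defensive.
Import Order.TTheory GRing.Theory Num.Theory.

(** * Decomposition of a graph of maximum degree two into paths and cycles *)

Section Components.
Variables (T : finType) (f : rel T).

(** The neighbourhood equation ranges over every [y] of the type, so the path is induced and is a
    whole component. Isolated vertices are excluded. *)
Definition path_comp (p : seq T) : Prop :=
  [/\ 1 < size p, uniq p & forall x0 i y, i < size p ->
    f (nth x0 p i) y = (0 < i) && (y == nth x0 p i.-1)
                       || (i.+1 < size p) && (y == nth x0 p i.+1)].

(** Adding [size c] before taking the predecessor avoids truncation at index 0. *)
Definition cycle_comp (c : seq T) : Prop :=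
  [/\ 2 < size c, uniq c & forall x0 i y, i < size c ->
    f (nth x0 c i) y = (y == nth x0 c (i.+1 %% size c))
                       || (y == nth x0 c ((i + size c).-1 %% size c))].

Hypotheses (fsym : symmetric f) (firr : irreflexive f).
Hypothesis deg_le2 : forall x, deg f x <= 2.

Lemma two_nbrs x a b y : f x a -> f x b -> a != b -> f x y = (y == a) || (y == b).
Proof.
move=> fa fb ab; have sub : [set a; b] \subset [set u | f x u].
  by apply/subsetP=> u; rewrite !inE => /orP[]/eqP->.
have /eqP E : [set a; b] == [set u | f x u].
  by rewrite eqEcard sub cards2 ab cardsE; apply: deg_le2.
by have := congr1 (fun A : {set T} => y \in A) E; rewrite !inE.
Qed.

Lemma one_nbr x a y : deg f x = 1 -> f x a -> f x y = (y == a).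
Proof.
move=> d1 fa; have sub : [set a] \subset [set u | f x u] by rewrite sub1set inE.
have /eqP E : [set a] == [set u | f x u].
  by rewrite eqEcard sub cards1 cardsE -/(deg f x) d1.
by have := congr1 (fun A : {set T} => y \in A) E; rewrite !inE.
Qed.

(** Take a path of maximal length among those starting at [x0]: a new neighbour of its last vertex
    would prolong it. *)
Lemma longest_path x0 : exists t, [/\ path f x0 t, uniq (x0 :: t) &
  forall y, f (last x0 t) y -> y \in x0 :: t].
Proof.
pose P n := [exists t : n.-tuple T, path f x0 t && uniq (x0 :: t)].
have P0 : exists n, P n by exists 0; apply/existsP; exists [tuple].
have Pub n : P n -> n <= #|T|.
  case/existsP=> t /andP[_ /card_uniqP ct].
  by have := max_card (mem (x0 :: t)); rewrite ct /= size_tuple => /ltnW.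
case: (ex_maxnP P0 Pub) => n /existsP[t /andP[pt ut]] nmax.
exists t; split=> // y fy; apply: contraT => yt.
have : P n.+1.
  apply/existsP; exists [tuple of rcons t y]; rewrite /= rcons_path pt fy.
  by move: ut yt; rewrite /= mem_rcons rcons_uniq !inE !negb_or eq_sym => /andP[-> ->] /andP[-> ->].
by move/nmax; rewrite ltnn.
Qed.

Section LongestPath.
Variables (x0 : T) (t : seq T).
Hypotheses (pt : path f x0 t) (ut : uniq (x0 :: t)).
Hypothesis maxt : forall y, f (last x0 t) y -> y \in x0 :: t.
Let w i := nth x0 (x0 :: t) i.
Let k := size (x0 :: t).

Lemma step_path i : i.+1 < k -> f (w i) (w i.+1).
Proof. by move=> ik; apply: (pathP x0 pt). Qed.

Lemma w_inj i j : i < k -> j < k -> (w i == w j) = (i == j).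
Proof. by move=> ik jk; rewrite nth_uniq. Qed.

Lemma inner_nbrs i y : 0 < i -> i.+1 < k -> f (w i) y = (y == w i.-1) || (y == w i.+1).
Proof.
move=> i0 ik; apply: two_nbrs; last by rewrite w_inj; lia.
  by rewrite fsym -{2}(prednK i0); apply: step_path; lia.
exact: step_path.
Qed.

(** An inner vertex already has both its neighbours on the path, so the last vertex can only be
    joined to its predecessor or back to the start. *)
Lemma last_nbrs y : f (w k.-1) y -> y = x0 \/ y = w k.-2.
Proof.
move=> fy; have yt : y \in x0 :: t by apply: maxt; rewrite -[last x0 t]/(last x0 (x0 :: t)) -nth_last.
have iy : index y (x0 :: t) < k by rewrite index_mem.
move: fy; rewrite -(nth_index x0 yt) -/(w _); set i := index _ _ in iy *.
have [->|i0] := posnP i; first by left.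
move=> fi; right; congr w; have ik1 : i != k.-1 by apply: contraTneq fi => ->; rewrite firr.
have ik : i.+1 < k by lia.
move: fi; rewrite fsym inner_nbrs // !w_inj; lia.
Qed.

End LongestPath.

(** A longest path that starts at a leaf cannot close up, so it exhausts its component. *)
Lemma path_from x0 : deg f x0 = 1 ->
  exists2 p, path_comp (x0 :: p) & path f x0 p.
Proof.
move=> d1; have [t [pt ut maxt]] := longest_path x0; exists t => //.
have /card_gt0P[y0 fy0] : 0 < deg f x0 by rewrite d1.
rewrite inE in fy0.
have k2 : 1 < size (x0 :: t).
  case: t pt ut maxt => //= _ _ /(_ y0 fy0); rewrite inE => /eqP y0x.
  by move: fy0; rewrite y0x firr.
split=> // x1 i y ik; rewrite (set_nth_default x0 x1 ik).
rewrite (set_nth_default x0 x1 (leq_ltn_trans (leq_pred i) ik)).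
have -> : (i.+1 < size (x0 :: t)) && (y == nth x1 (x0 :: t) i.+1) =
          (i.+1 < size (x0 :: t)) && (y == nth x0 (x0 :: t) i.+1).
  by case: ltnP => // h; rewrite (set_nth_default x0 x1 h).
have sp := step_path pt; have wi := w_inj ut; have inn := inner_nbrs pt ut.
have [i0|i0] := posnP i.
  by rewrite i0 k2 /= (@one_nbr _ (nth x0 t 0)) //; apply: (sp 0).
rewrite /=; have [ik1|ik1] := ltnP i.+1 (size (x0 :: t)); first exact: inn.
rewrite orbF; have ei : i = (size (x0 :: t)).-1 by lia.
apply/idP/eqP => [|->]; last first.
  by rewrite fsym -{2}(prednK i0); apply: sp; lia.
(* If the last vertex is joined to [x0], it is the only neighbour of the leaf, that is the second
   vertex; then [x0] is its predecessor. *)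
rewrite ei => fy; case: (last_nbrs pt ut maxt fy) => // yx; rewrite yx in fy *.
have : f x0 (nth x0 (x0 :: t) (size (x0 :: t)).-1) by rewrite fsym.
rewrite (@one_nbr _ (nth x0 (x0 :: t) 1)) //; last by apply: (sp 0).
rewrite wi; [|by lia|by lia].
by move=> /eqP ->.
Qed.

(** The last vertex of a longest path has two distinct neighbours, hence is joined both to its
    predecessor and to [x0]. *)
Lemma cycle_from x0 : (forall y, connect f x0 y -> deg f y = 2) ->
  exists2 c, cycle_comp (x0 :: c) & path f x0 c.
Proof.
move=> dc; have [t [pt ut maxt]] := longest_path x0; exists t => //.
have sp := step_path pt; have wi := w_inj ut; have inn := inner_nbrs pt ut.
have lst := last_nbrs pt ut maxt.
set w := fun i => nth x0 (x0 :: t) i in sp wi inn lst.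
set k := size (x0 :: t) in sp wi inn lst *.
have dl : deg f (w k.-1) = 2.
  by apply: dc; apply/connectP; exists t; rewrite // /w nth_last.
have ex0 : f (w k.-1) x0 /\ (k > 2).
  have /card_gt1P[a [b [fa fb ab]]] : 1 < deg f (w k.-1) by rewrite dl.
  rewrite !inE in fa fb.
  have kx : x0 <> w k.-2 -> 2 < k.
    by move=> h; rewrite ltnNge; apply/negP=> k3; apply: h; rewrite /w (_ : k.-2 = 0) //; lia.
  case: (lst a fa) (lst b fb) => ea [] eb; rewrite ?ea ?eb in fa fb ab *; try by rewrite eqxx in ab.
    by split=> //; apply: kx; apply/eqP.
  by split=> //; apply: kx; apply/eqP; rewrite eq_sym.
case: ex0 => flast k3.
split=> // x1 i y ik; rewrite !(set_nth_default x0 x1) // ?ltn_pmod //; try lia.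
rewrite -/k -!/(w _).
have [i0|i0] := posnP i.
  rewrite i0 add0n !modn_small //; try lia.
  apply: two_nbrs; [apply: sp; lia|by rewrite fsym|rewrite wi; lia].
have [ik1|ik1] := ltnP i.+1 k.
  rewrite inn // orbC modn_small //; congr (_ || (_ == w _)).
  have -> : (i + k).-1 = i.-1 + k by lia.
  by rewrite modnDr modn_small; lia.
have ei : i = k.-1 by lia.
have -> : i.+1 %% k = 0 by rewrite ei prednK ?modnn; lia.
have -> : (i + k).-1 %% k = k.-2.
  have -> : (i + k).-1 = k.-2 + k by lia.
  by rewrite modnDr modn_small; lia.
rewrite ei; apply: two_nbrs => //; last by rewrite (wi 0); lia.
rewrite fsym {2}(_ : k.-1 = k.-2.+1); last by lia.
by apply: sp; lia.
Qed.

Lemma path_comp_closed p x y : path_comp p -> x \in p -> f x y -> y \in p.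
Proof.
case=> _ _ h xp; have ip : index x p < size p by rewrite index_mem.
rewrite -{1}(nth_index x xp) h // => /orP[] /andP[h1 /eqP->]; rewrite mem_nth //.
by rewrite (leq_ltn_trans (leq_pred _)).
Qed.

Lemma cycle_comp_closed p x y : cycle_comp p -> x \in p -> f x y -> y \in p.
Proof.
case=> k3 _ h xp; have ip : index x p < size p by rewrite index_mem.
by rewrite -{1}(nth_index x xp) h // => /orP[] /eqP->; rewrite mem_nth // ltn_pmod //; lia.
Qed.

(** Strong induction on the size of [S]: split off the path that starts at a leaf, or a cycle if
    there is no leaf. By symmetry the rest is again closed under adjacency. *)
Lemma components (S : {set T}) : (forall x y, x \in S -> f x y -> y \in S) ->
  (forall x, x \in S -> 0 < deg f x) ->
  exists ps cs, [/\ forall p, p \in ps -> path_comp p, forall c, c \in cs -> cycle_comp c &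
    perm_eq (flatten (ps ++ cs)) (enum S)].
Proof.
have [n] := ubnP #|S|; elim: n S => // n IHn S Sn Scl Spos.
have [S0|/set0Pn[x0 x0S]] := eqVneq S set0.
  by exists [::], [::]; rewrite S0 enum_set0.
have Sconn x y : x \in S -> connect f x y -> y \in S.
  by move=> xS /connectP[p]; elim: p x xS => [|z p IHp] x xS /= => [_ ->//|/andP[/(Scl _ _ xS)]]; exact: IHp.
have rec p : (forall x y, x \in p -> f x y -> y \in p) -> uniq p -> {subset p <= S} ->
    p != [::] -> exists ps cs,
    [/\ forall p, p \in ps -> path_comp p, forall c, c \in cs -> cycle_comp c &
    perm_eq (p ++ flatten (ps ++ cs)) (enum S)].
  move=> pcl up pS p0; pose S' := S :\: [set x in p].
  have [|||ps [cs [h1 h2 h3]]] := IHn S'.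
  - rewrite (leq_trans _ (_ : #|S| <= n)) // proper_card //; apply/properP; split.
      exact: subsetDl.
    rewrite /S'; case: p p0 pS {pcl up S'} => // a p _ pS; exists a; first by apply: pS; rewrite mem_head.
    by rewrite !inE eqxx.
  - move=> x y; rewrite !inE => /andP[xp xS] fxy; rewrite (Scl x) // andbT.
    by apply: contra xp => yp; apply: (pcl y); rewrite // fsym.
  - by move=> x; rewrite inE => /andP[_ /Spos].
  - exists ps, cs; split=> //; apply: uniq_perm; rewrite ?enum_uniq //.
      rewrite cat_uniq up (perm_uniq h3) enum_uniq andbT /=; apply/hasPn=> x.
      by rewrite (perm_mem h3) mem_enum !inE => /andP[].
    move=> x; rewrite mem_cat (perm_mem h3) !mem_enum !inE.
    by case xp : (x \in p) => //=; rewrite pS.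
have [/existsP[x /andP[xS /eqP dx]]|no1] := boolP [exists x, (x \in S) && (deg f x == 1)].
  have [p pc pf] := path_from dx.
  have pcl a b : a \in x :: p -> f a b -> b \in x :: p by apply: path_comp_closed.
  have [||ps [cs [h1 h2 h3]]] := rec (x :: p) pcl _ _ isT.
  - by case: pc.
  - by move=> y yp; apply: (Sconn x) => //; apply: (path_connect pf).
  - by exists ((x :: p) :: ps), cs; split=> // r; rewrite inE => /orP[/eqP->|/h1].
have d2 y : y \in S -> deg f y = 2.
  move=> yS; have := deg_le2 y; have := Spos y yS; move: no1.
  by rewrite negb_exists => /forallP/(_ y); rewrite yS /=; lia.
have [|p pc pf] := @cycle_from x0.
  by move=> y /(Sconn _ _ x0S)/d2.
have pcl a b : a \in x0 :: p -> f a b -> b \in x0 :: p by apply: cycle_comp_closed.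
have [||ps [cs [h1 h2 h3]]] := rec (x0 :: p) pcl _ _ isT.
- by case: pc.
- by move=> y yp; apply: (Sconn x0) => //; apply: (path_connect pf).
- exists ps, ((x0 :: p) :: cs); split=> //.
    by move=> r; rewrite inE => /orP[/eqP->|/h2].
  rewrite (perm_trans _ h3) // !flatten_cat.
  by rewrite -[flatten (_ :: cs)]/((x0 :: p) ++ flatten cs) perm_catCA.
Qed.
End Components.

Local Open Scope ring_scope.
Local Open Scope sesquilinear_scope.

(** * Unitary similarity of cospectral graphs *)

Lemma char_poly_conj (R : comUnitRingType) n (P D : 'M[R]_n) :
  P \in unitmx -> char_poly (invmx P *m D *m P) = char_poly D.
Proof.
move=> Pu; rewrite /char_poly.
have e1 : map_mx polyC (invmx P) *m map_mx polyC P = 1%:M.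
  by rewrite -map_mxM mulVmx // map_mx1.
have -> : char_poly_mx (invmx P *m D *m P) =
   map_mx polyC (invmx P) *m char_poly_mx D *m map_mx polyC P.
  rewrite /char_poly_mx !map_mxM mulmxBr mulmxBl scalar_mxC.
  by rewrite -[_ *m _ *m map_mx _ P in RHS]mulmxA e1 mulmx1.
by rewrite !det_mulmx mulrAC -det_mulmx e1 det1 mul1r.
Qed.

Lemma hermitian_char_poly n (A : 'M[algC]_n) : A \is hermsymmx ->
  char_poly A = \prod_(x <- [tuple spectral_diag A 0 i | i < n]) ('X - x%:P).
Proof.
move=> /hermitian_normalmx/orthomx_spectralP eA.
rewrite {1}eA char_poly_conj ?spectral_unit // char_poly_trig ?diag_mx_is_trig //.
rewrite big_map big_enum /=; apply: eq_bigr => i _.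
by rewrite mxE eqxx mulr1n.
Qed.

(** Both matrices are unitarily diagonalisable and their eigenvalue lists differ by a permutation;
    [V] is the permutation matrix placed between the two unitaries. It is typed as rectangular
    because the two vertex sets are only known afterwards to be equinumerous. *)
Lemma hermitian_cospectral n m (A : 'M[algC]_n) (B : 'M[algC]_m) :
  A \is hermsymmx -> B \is hermsymmx -> char_poly A = char_poly B ->
  exists V : 'M[algC]_(n, m),
    [/\ V *m V^t* = 1%:M, V^t* *m V = 1%:M & A *m V = V *m B].
Proof.
move=> hA hB eAB; have emn : n = m.
  by move: (congr1 (fun p : {poly algC} => size p) eAB); rewrite !size_char_poly => -[].
subst m.
move: eAB; rewrite !hermitian_char_poly // => /prod_XsubC_eq.
case/tuple_permP=> s es.
have es' i : spectral_diag A 0 i = spectral_diag B 0 (s i).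
  have := congr1 (fun t => nth 0 t i) es.
  by rewrite -!tnth_nth !tnth_mktuple.
have /hermitian_normalmx/orthomx_spectralP eA := hA.
have /hermitian_normalmx/orthomx_spectralP eB := hB.
set U := spectralmx A in eA; set W := spectralmx B in eB.
have uU : U \is unitarymx by apply: spectral_unitarymx.
have uW : W \is unitarymx by apply: spectral_unitarymx.
have uP : (perm_mx s : 'M[algC]_n) \is unitarymx.
  apply/unitarymxP; rewrite tr_perm_mx map_perm_mx -perm_mxM.
  by rewrite mulgV perm_mx1.
pose V := U^t* *m perm_mx s *m W.
have uV : V \is unitarymx by rewrite !mul_unitarymx // trmxC_unitary.
exists V; split; first exact/unitarymxP.
  by apply: mulmx1C; exact/unitarymxP.
rewrite eA eB /V !mulmxA.
rewrite -invmx_unitary // -[_ *m U *m _]mulmxA mulmxV ?spectral_unit // mulmx1.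
rewrite -[_ *m W *m _]mulmxA mulmxV ?spectral_unit // mulmx1.
congr (_ *m _); rewrite -!mulmxA; congr (_ *m _).
apply/matrixP=> i j; rewrite mul_diag_mx mul_mx_diag !mxE es'.
by case: eqP => [->|]; rewrite ?(mulr0, mul0r, mulr1, mul1r).
Qed.

Lemma sum_enum_val (R : nmodType) (T : finType) (F : T -> R) :
  \sum_x F x = \sum_(i < #|T|) F (enum_val i).
Proof. by rewrite -(big_enum_val (A := T)). Qed.

Lemma not_all0 (T : finType) (z : T -> algC) :
  ~ (forall x, z x = 0) -> exists x, z x != 0.
Proof.
move=> nz; apply/existsP; apply: contra_notT nz => /existsPn z0 x.
by apply/eqP; rewrite -[_ == _]negbK z0.
Qed.

(** The action of [Qmx] on functions on the vertices, which keeps the enumeration of [T] out of the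
    graph computations. *)
Definition Qop (C : numClosedFieldType) (T : finType) (e : rel T) (v : T -> C) (x : T) : C :=
  (deg e x)%:R * v x + \sum_(y | e x y) v y.

Definition Qform (C : numClosedFieldType) (T : finType) (e : rel T) (z : T -> C) : C :=
  \sum_x (z x)^* * Qop e z x.

Definition sqnorm (C : numClosedFieldType) (T : finType) (z : T -> C) : C := \sum_x (z x)^* * z x.

Definition cvec (T : finType) (z : T -> algC) : 'cV[algC]_#|T| :=
  \col_i z (enum_val i).

Section Vectors.
Variables (T : finType) (e : rel T).
Implicit Types z w : T -> algC.

Lemma cvecK (u : 'cV[algC]_#|T|) : cvec (fun x => u (enum_rank x) 0) = u.
Proof. by apply/colP=> i; rewrite mxE enum_valK. Qed.

Lemma cvecE z x : cvec z (enum_rank x) 0 = z x.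
Proof. by rewrite mxE enum_rankK. Qed.

Lemma Qmx_cvec z : Qmx e *m cvec z = cvec (Qop e z).
Proof.
apply/colP=> i; rewrite !mxE /Qop [RHS]addrC [in RHS]big_mkcond /=.
rewrite (sum_enum_val (T := T)) /=.
transitivity (\sum_(j < #|T|) (((e (enum_val i) (enum_val j))%:R * z (enum_val j))
   + (i == j)%:R * ((deg e (enum_val i))%:R * z (enum_val j)))).
  by apply: eq_bigr => j _; rewrite !mxE mulrDl mulrA.
rewrite big_split /=; congr (_ + _).
  by apply: eq_bigr => j _; case: (e _ _); rewrite ?mul1r ?mul0r.
rewrite (bigD1 i) //= eqxx mul1r big1 ?addr0 // => j /negPf.
by rewrite eq_sym => ->; rewrite mul0r.
Qed.

Lemma dot_cvec z w : (cvec z)^t* *m cvec w = (\sum_x (z x)^* * w x)%:M.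
Proof.
apply/matrixP=> i j; rewrite !ord1 !mxE eqxx mulr1n (sum_enum_val (T := T)) /=.
by apply: eq_bigr => k _; rewrite !mxE.
Qed.

Lemma Qmx_herm : symmetric e -> Qmx e \is hermsymmx.
Proof.
move=> se; apply: realsym_hermsym.
  apply/is_hermitianmxP; rewrite expr0 scale1r; apply/matrixP=> i j; rewrite !mxE.
  by rewrite se eq_sym; case: eqP => [->|]; rewrite ?mul0r.
by apply/mxOverP=> i j; rewrite mxE rpredD ?rpredM ?realn.
Qed.

Lemma tr_Qmx : irreflexive e -> \tr (Qmx e) = (\sum_x deg e x)%:R.
Proof.
move=> ie; rewrite natr_sum (sum_enum_val (T := T)) /=; apply: eq_bigr => i _.
by rewrite mxE ie eqxx mul1r add0r.
Qed.

(** A diagonal entry of the square is the squared degree plus one for each neighbour. *)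
Lemma tr_Qmx2 : simple_graph e ->
  \tr (Qmx e *m Qmx e) = (\sum_x (deg e x ^ 2 + deg e x))%:R.
Proof.
case=> se ie; rewrite natr_sum (sum_enum_val (T := T)) /=; apply: eq_bigr => i _.
rewrite mxE (bigD1 i) //= !mxE ie eqxx mul1r add0r -natrM natrD; congr (_ + _).
have -> : deg e (enum_val i) = (\sum_(x : T) e (enum_val i) x)%N.
  by rewrite /deg -sum1_card big_mkcond; apply: eq_bigr => x _; rewrite inE; case: (e _ _).
rewrite natr_sum (sum_enum_val (T := T)) /= [RHS](bigD1 i) //=.
rewrite ie add0r; apply: eq_bigr => j ij; rewrite !mxE (se (enum_val j)).
rewrite [i == j]eq_sym (negPf ij) !mul0r !addr0 -natrM.
by case: (e _ _).
Qed.

End Vectors.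

(** * Transfer of invariants between cospectral graphs *)

Section Transfer.
Variables (T1 T2 : finType) (e1 : rel T1) (e2 : rel T2).
Hypotheses (g1 : simple_graph e1) (g2 : simple_graph e2) (cosp : Q_cospectral e1 e2).

Lemma cospectral_unitary : exists V : 'M[algC]_(#|T1|, #|T2|),
    [/\ V *m V^t* = 1%:M, V^t* *m V = 1%:M & Qmx e1 *m V = V *m Qmx e2].
Proof.
by apply: hermitian_cospectral => //; apply: Qmx_herm; [case: g1|case: g2].
Qed.

Lemma cospectral_card : #|T1| = #|T2|.
Proof.
move: (congr1 (fun p : {poly algC} => size p) cosp).
by rewrite !size_char_poly => -[].
Qed.

Lemma cospectral_deg : (\sum_x deg e1 x = \sum_x deg e2 x)%N.
Proof.
have [V [V1 V2 VQ]] := cospectral_unitary.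
apply/eqP; rewrite -(eqr_nat algC); apply/eqP; rewrite -!tr_Qmx; [|by case: g2|by case: g1].
by rewrite -[Qmx e1]mulmx1 -V1 mulmxA VQ mxtrace_mulC !mulmxA V2 mul1mx.
Qed.

Lemma cospectral_deg2 : (\sum_x deg e1 x ^ 2 = \sum_x deg e2 x ^ 2)%N.
Proof.
have [V [V1 V2 VQ]] := cospectral_unitary.
apply: (@addIn (\sum_x deg e1 x)); rewrite [in RHS]cospectral_deg -!big_split /=.
apply/eqP; rewrite -(eqr_nat algC); apply/eqP; rewrite -!tr_Qmx2 //.
rewrite -[X in \tr (_ *m X)]mulmx1 -V1 !mulmxA -(mulmxA _ _ V) VQ mulmxA VQ.
by rewrite mxtrace_mulC !mulmxA V2 mul1mx.
Qed.

(** The unitary [V], read on functions. The last clause pulls a linear form back, so that a bound on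
    a hyperplane for one graph becomes a bound on a hyperplane for the other. *)
Lemma cospectral_isometry : exists Phi : (T2 -> algC) -> T1 -> algC,
  [/\ forall z, sqnorm (Phi z) = sqnorm z,
      forall z, Qform e1 (Phi z) = Qform e2 z,
      forall z, (exists x, z x != 0) -> exists x, Phi z x != 0
    & forall l : T1 -> algC, exists l' : T2 -> algC,
        forall z, \sum_x l x * Phi z x = \sum_x l' x * z x].
Proof.
have [V [V1 V2 VQ]] := cospectral_unitary.
pose Phi z := fun x => (V *m cvec z) (enum_rank x) 0.
have cPhi z : cvec (Phi z) = V *m cvec z by apply: cvecK.
have sc (a b : algC) : a%:M = b%:M :> 'M_1 -> a = b.
  by move/matrixP/(_ 0 0); rewrite !mxE !mulr1n.
exists Phi; split.
- move=> z; apply: sc; rewrite -!dot_cvec cPhi trmx_mul map_mxM mulmxA.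
  by rewrite -(mulmxA _ _ V) V2 mulmx1.
- move=> z; apply: sc; rewrite -!dot_cvec -!Qmx_cvec cPhi trmx_mul map_mxM.
  by rewrite (mulmxA (Qmx e1)) VQ !mulmxA -(mulmxA _ _ V) V2 mulmx1.
- move=> z [x zx]; apply: not_all0 => z0.
  case/negP: zx; apply/eqP; have: cvec z = 0.
    rewrite -[cvec z]mul1mx -V2 -mulmxA -cPhi.
    suff -> : cvec (Phi z) = 0 by rewrite mulmx0.
    by apply/colP=> i; rewrite mxE z0 mxE.
  by move=> ez; rewrite -cvecE ez mxE.
- move=> l; exists (fun y => \sum_x l x * V (enum_rank x) (enum_rank y)) => z.
  under [RHS]eq_bigr do rewrite mulr_suml.
  rewrite exchange_big /=; apply: eq_bigr => x _; rewrite /Phi mxE mulr_sumr.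
  rewrite (sum_enum_val (T := T2)) /=.
  by apply: eq_bigr => y _; rewrite mxE enum_valK mulrA.
Qed.

(** The adjoint of [V] carries the [m] independent eigenfunctions over; fewer than [m] vanishing
    conditions leave a nonzero combination of them. *)
Lemma cospectral_eigen m (g : 'I_m -> T1 -> algC) lam (S : seq T2) :
  (forall k x, Qop e1 (g k) x = lam * g k x) ->
  (forall a : 'I_m -> algC, (forall x, \sum_k a k * g k x = 0) -> forall k, a k = 0) ->
  (size S < m)%N ->
  exists v : T2 -> algC, [/\ exists x, v x != 0,
    forall x, Qop e2 v x = lam * v x & forall x, x \in S -> v x = 0].
Proof.
move=> geig gfree Sm.
have [V [V1 V2 VQ]] := cospectral_unitary.
have VQ' : Qmx e2 *m V^t* = V^t* *m Qmx e1.
  by rewrite -[LHS]mul1mx -V2 -!mulmxA (mulmxA V) -VQ -!mulmxA V1 mulmx1.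
pose h k := V^t* *m cvec (g k).
pose M : 'M[algC]_(m, size S) := \matrix_(k, i) h k (enum_rank (tnth (in_tuple S) i)) 0.
(* [M] lists the values of the [m] transported functions on [S]; its rank is at most
   [size S < m]. *)
have /rowV0Pn[a /sub_kermxP aM a0] : kermx M != 0.
  by rewrite -mxrank_eq0 mxrank_ker subn_eq0 -ltnNge (leq_ltn_trans (rank_leq_col M)).
pose u := \sum_k a 0 k *: h k.
pose gs x := \sum_k a 0 k * g k x.
have uE : u = V^t* *m cvec gs.
  rewrite /u /h; under eq_bigr do rewrite scalemxAr.
  rewrite -mulmx_sumr; congr (_ *m _); apply/colP=> i.
  by rewrite !mxE summxE; apply: eq_bigr => k _; rewrite !mxE.
have eigs : Qmx e1 *m cvec gs = lam *: cvec gs.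
  rewrite Qmx_cvec; apply/colP=> i; rewrite !mxE /gs.
  rewrite mulr_sumr; under [RHS]eq_bigr do rewrite mulrCA -geig /Qop mulrDr.
  rewrite big_split /= /Qop mulr_sumr; congr (_ + _).
    by apply: eq_bigr => k _; rewrite mulrCA.
  by rewrite exchange_big /=; apply: eq_bigr => k _; rewrite mulr_sumr.
exists (fun x => u (enum_rank x) 0); split.
- apply: not_all0 => z0.
  case/negP: a0; apply/eqP/rowP=> k; rewrite [RHS]mxE; move: k.
  apply: gfree => x; have: cvec gs = 0.
    rewrite -[LHS]mul1mx -V1 -mulmxA -uE.
    suff -> : u = 0 by rewrite mulmx0.
    by apply/colP=> i; have := z0 (enum_val i); rewrite enum_valK mxE.
  by move=> e0; rewrite -/(gs x) -cvecE e0 mxE.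
- move=> x; rewrite -cvecE -Qmx_cvec cvecK uE mulmxA VQ' -mulmxA eigs.
  by rewrite -scalemxAr mxE.
- move=> x xS; have iS : (index x S < size S)%N by rewrite index_mem.
  have := congr1 (fun A : 'rV_(size S) => A 0 (Ordinal iS)) aM; rewrite !mxE => <-.
  rewrite /u summxE; apply: eq_bigr => k _; rewrite [LHS]mxE; congr (_ * _).
  by rewrite !mxE (tnth_nth x) /= nth_index // !mxE.
Qed.

End Transfer.

(** * The graph K_1 v (C_s u qK_2) *)

Section Target.
Variable C : numClosedFieldType.
Variables q s : nat.
Hypothesis s_ge3 : (2 < s)%N.
Let ctr : Gvert q s := inl tt.
Let cyc (i : 'I_s) : Gvert q s := inr (inl i).
Let tip (j : 'I_q) (b : bool) : Gvert q s := inr (inr (j, b)).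

Lemma sum_Gvert (R : nmodType) (F : Gvert q s -> R) :
  \sum_x F x = F ctr + (\sum_i F (cyc i) + \sum_j (F (tip j true) + F (tip j false))).
Proof.
rewrite big_sumType /= (big_pred1 tt) /=; last by case.
congr (_ + _); rewrite big_sumType /=; congr (_ + _).
rewrite (reindex (fun p : 'I_q * bool => (p.1, p.2))) /=; last first.
  by exists id => [[]|[]].
rewrite -(pair_bigA _ (fun j b => F (inr (inr (j, b))))) /=.
by apply: eq_bigr => j _; rewrite big_bool.
Qed.

Lemma ordS_neq (i : 'I_s) : ordS i != i.
Proof.
rewrite -val_eqE /=; have := ltn_ord i; rewrite leq_eqVlt => /orP[/eqP es|].
  by rewrite es modnn; lia.
by move=> lis; rewrite modn_small //; lia.
Qed.

Lemma ordS_neq_pred (i : 'I_s) : ordS i != ord_pred i.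
Proof.
rewrite -(inj_eq (@ordS_inj s)) ord_predK -val_eqE /=.
have := ltn_ord i; case: i => i lis _ /=.
have [e1|ne1] := eqVneq i.+1 s; first by rewrite e1 modnn modn_small; lia.
rewrite (@modn_small i.+1); last by lia.
have [e2|ne2] := eqVneq i.+2 s; first by rewrite e2 modnn; lia.
by rewrite modn_small; lia.
Qed.

Lemma cycle_relE (i j : 'I_s) : cycle_rel i j = (j == ordS i) || (j == ord_pred i).
Proof.
rewrite /cycle_rel; congr (_ || _); rewrite -[LHS]/(i == ordS j).
by rewrite -(inj_eq (@ordS_inj s) j) ord_predK eq_sym.
Qed.

Lemma Grel_simple : simple_graph (Grel q s).
Proof.
split.
  move=> [[]|[i|[j b]]] [[]|[i'|[j' b']]] //=; first by rewrite /cycle_rel orbC.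
  by rewrite /copies_rel /K2_rel /= eq_sym [b == _]eq_sym.
move=> [[]|[i|[j b]]] //=.
  rewrite cycle_relE eq_sym (negPf (ordS_neq i)) /=.
  by rewrite -(inj_eq (@ordS_inj s)) ord_predK (negPf (ordS_neq i)).
by rewrite /copies_rel /K2_rel /= !eqxx.
Qed.

Lemma nbr_sum_ctr (R : nmodType) (F : Gvert q s -> R) :
  \sum_(y | Grel q s ctr y) F y =
  \sum_i F (cyc i) + \sum_j (F (tip j true) + F (tip j false)).
Proof. by rewrite big_mkcond sum_Gvert /= add0r. Qed.

Lemma nbr_sum_cyc (R : nmodType) (F : Gvert q s -> R) i :
  \sum_(y | Grel q s (cyc i) y) F y = F ctr + (F (cyc (ordS i)) + F (cyc (ord_pred i))).
Proof.
rewrite big_mkcond sum_Gvert /=; congr (_ + _).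
rewrite [X in _ + X]big1 ?addr0; last by move=> j _; rewrite ?addr0.
rewrite (bigD1 (ordS i)) //= cycle_relE eqxx /=; congr (_ + _).
rewrite (bigD1 (ord_pred i)) 1?eq_sym ?ordS_neq_pred //= cycle_relE eqxx orbT.
rewrite big1 ?addr0 // => j /andP[/negPf j1 /negPf j2].
by rewrite cycle_relE j1 j2.
Qed.

Lemma nbr_sum_tip (R : nmodType) (F : Gvert q s -> R) j b :
  \sum_(y | Grel q s (tip j b) y) F y = F ctr + F (tip j (~~ b)).
Proof.
rewrite big_mkcond sum_Gvert /=; congr (_ + _).
rewrite big1 ?add0r // (bigD1 j) //= /copies_rel /K2_rel /= eqxx /= big1 ?addr0.
  by case: b; rewrite /= ?add0r ?addr0.
by move=> k /negPf; rewrite eq_sym => ->; rewrite addr0.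
Qed.

Lemma degE (T : finType) (e : rel T) x : deg e x = (\sum_(y | e x y) 1)%N.
Proof. by rewrite /deg -sum1_card; apply: eq_bigl => y; rewrite inE. Qed.

Lemma deg_ctr : deg (Grel q s) ctr = (s + 2 * q)%N.
Proof.
rewrite degE nbr_sum_ctr !sum_nat_const !card_ord; lia.
Qed.

Lemma deg_cyc i : deg (Grel q s) (cyc i) = 3.
Proof. by rewrite degE nbr_sum_cyc. Qed.

Lemma deg_tip j b : deg (Grel q s) (tip j b) = 2.
Proof. by rewrite degE nbr_sum_tip. Qed.

Lemma card_Gvert : #|Gvert q s| = (s + 2 * q).+1.
Proof. by rewrite !card_sum card_unit card_prod !card_ord card_bool; lia. Qed.

Lemma sum_Gvert_nat (F : Gvert q s -> nat) :
  (\sum_x F x = F ctr + (\sum_i F (cyc i) + \sum_j (F (tip j true) + F (tip j false))))%N.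
Proof. exact: (@sum_Gvert nat). Qed.

Lemma sum_deg_Grel : (\sum_x deg (Grel q s) x = (s + 2 * q) + 3 * s + 4 * q)%N.
Proof.
rewrite sum_Gvert_nat deg_ctr; under eq_bigr do rewrite deg_cyc.
under [X in (_ + (_ + X))%N]eq_bigr do rewrite !deg_tip.
by rewrite !sum_nat_const !card_ord; lia.
Qed.

Lemma sum_deg2_Grel :
  (\sum_x deg (Grel q s) x ^ 2 = (s + 2 * q) ^ 2 + 9 * s + 8 * q)%N.
Proof.
rewrite sum_Gvert_nat deg_ctr; under eq_bigr do rewrite deg_cyc.
under [X in (_ + (_ + X))%N]eq_bigr do rewrite !deg_tip.
by rewrite !sum_nat_const !card_ord; lia.
Qed.

Lemma sum_ordS (F : 'I_s -> C) : \sum_i F (ordS i) = \sum_i F i.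
Proof. by rewrite [RHS](reindex (@ordS s)) //; apply/onW_bij/ordS_bij. Qed.

Lemma sum_ord_pred (F : 'I_s -> 'I_s -> C) :
  \sum_i F i (ord_pred i) = \sum_i F (ordS i) i.
Proof.
rewrite [LHS](reindex (@ordS s)); last by apply/onW_bij/ordS_bij.
by apply: eq_bigr => i _; rewrite ordSK.
Qed.

Local Notation sq z := (z^* * z).

Lemma sq_ge0 (z : C) : 0 <= sq z.
Proof. by rewrite mulrC mul_conjC_ge0. Qed.

Lemma sq2_ge0 (x y : C) : 0 <= sq x + 2%:R * sq y.
Proof. by apply: addr_ge0; [|apply: mulr_ge0; [exact: ler0n|]]; exact: sq_ge0. Qed.

(** The signless Laplacian form is the sum of |z_x + z_y|^2 over the edges: first spokes and edges
    of the cycle, then the triangles through the centre. *)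
Lemma Qform_Grel (z : Gvert q s -> C) : Qform (Grel q s) z =
  \sum_i (sq (z ctr + z (cyc i)) + sq (z (cyc i) + z (cyc (ordS i)))) +
  \sum_j (sq (z ctr + z (tip j true)) + sq (z ctr + z (tip j false))
          + sq (z (tip j true) + z (tip j false))).
Proof.
rewrite /Qform sum_Gvert /Qop deg_ctr nbr_sum_ctr.
under [X in _ + (X + _)]eq_bigr do rewrite deg_cyc nbr_sum_cyc.
under [X in _ + (_ + X)]eq_bigr do rewrite !deg_tip !nbr_sum_tip /=.
set a := z ctr; pose c i := z (cyc i); pose t j b := z (tip j b).
rewrite -/c -/t.
have ea : (s + 2 * q)%:R * a = \sum_(i < s) a + \sum_(j < q) (a + a).
  by rewrite !sumr_const !card_ord natrD natrM -[a *+ s]mulr_natl -[(a + a) *+ q]mulr_natl; ring.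
rewrite ea addrACA -!big_split mulrDr addrACA !mulr_sumr -!big_split /=.
congr (_ + _); last first.
  by apply: eq_bigr => j _; rewrite !rmorphD /= /t /c; ring.
transitivity (\sum_i (a^* * (a + c i) + (c i)^* * (3 * c i + a + c (ordS i)))
   + \sum_i (c i)^* * c (ord_pred i)).
  by rewrite -big_split /=; apply: eq_bigr => i _; rewrite /c; ring.
rewrite (sum_ord_pred (fun i j => (c i)^* * c j)) -big_split /=.
transitivity (\sum_i (sq (a + c i) + (sq (c i) + (c i)^* * c (ordS i) + (c (ordS i))^* * c i))
   + \sum_i sq (c i)).
  by rewrite -big_split /=; apply: eq_bigr => i _; rewrite !rmorphD /=; ring.
rewrite -(sum_ordS (fun i => sq (c i))) -big_split /=.
by apply: eq_bigr => i _; rewrite !rmorphD /= /c; ring.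
Qed.

(** Completing squares: with a, c, t the values at the centre, on the cycle and on the copies of
    K_2, the difference is the sum of the |c_i + c_(i+1) + a/2|^2, of the |t_j + t'_j + a|^2, and of
    ((s - 1) - s/4 + q)|a|^2, whose coefficient is nonnegative. *)
Lemma Qform_Grel_ge (z : Gvert q s -> C) : sqnorm z <= Qform (Grel q s) z.
Proof.
rewrite Qform_Grel /sqnorm sum_Gvert.
set a := z ctr; pose c i := z (cyc i); pose t j b := z (tip j b).
rewrite -/c -/t -subr_ge0.
have -> : sq a = (s + 2 * q)%:R * sq a - (s + 2 * q - 1)%:R * sq a.
  by rewrite -mulrBl -natrB ?leq_subr // subKn ?mul1r //; lia.
have -> : (s + 2 * q - 1)%:R * sq a = \sum_(i < s) (4%:R^-1 * sq a) + \sum_(j < q) sq a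
   + ((s - 1)%:R - s%:R / 4%:R + q%:R) * sq a.
  rewrite !sumr_const !card_ord -[(_ * _) *+ s]mulr_natl -[(_ * _) *+ q]mulr_natl.
  have -> : (s + 2 * q - 1 = (s - 1) + q + q)%N by lia.
  by rewrite !natrD; field.
have -> : (s + 2 * q)%:R * sq a = \sum_(i < s) sq a + \sum_(j < q) (sq a + sq a).
  by rewrite !sumr_const !card_ord natrD natrM -[(_ * _) *+ s]mulr_natl -[(_ + _) *+ q]mulr_natl; ring.
(* Rotating the index shares the cross terms between the two ends of each cycle edge, so that [a] is
   paired with [c i + c (ordS i)]. *)
have half : \sum_i (a^* * c i + (c i)^* * a) =
   \sum_i (a^* * (c i + c (ordS i)) + (c i + c (ordS i))^* * a) / 2%:R.
  transitivity (\sum_i ((a^* * c i + (c i)^* * a) / 2%:R +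
                        (a^* * c (ordS i) + (c (ordS i))^* * a) / 2%:R)).
    rewrite [in RHS]big_split /= (sum_ordS (fun i => (a^* * c i + (c i)^* * a) / 2%:R)) -big_split /=.
    by apply: eq_bigr => i _; field.
  by apply: eq_bigr => i _; rewrite !rmorphD /=; field.
have -> : \sum_i (sq (a + c i) + sq (c i + c (ordS i))) =
   \sum_(i < s) sq a + \sum_i (sq (c i + c (ordS i) + a / 2%:R) - 4%:R^-1 * sq a)
   + \sum_i sq (c i).
  transitivity (\sum_(i < s) sq a + \sum_i (a^* * c i + (c i)^* * a)
                + \sum_i sq (c i + c (ordS i)) + \sum_i sq (c i)).
    by rewrite -!big_split /=; apply: eq_bigr => i _; rewrite !rmorphD /=; ring.
  rewrite half -!big_split /=; apply: eq_bigr => i _.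
  by rewrite !rmorphD !rmorphM /= fmorphV /= !rmorph_nat; field.
rewrite sumrB.
have -> : \sum_j (sq (a + t j true) + sq (a + t j false) + sq (t j true + t j false)) =
  \sum_(j < q) (sq a + sq a) + (\sum_j sq (t j true + t j false + a) - \sum_(j < q) sq a)
  + \sum_j (sq (t j true) + sq (t j false)).
  rewrite -sumrB -!big_split /=; apply: eq_bigr => j _; rewrite !rmorphD /=; ring.
set X1 := \sum_i sq (c i + _ + _); set X2 := \sum_j sq (t j true + t j false + _).
set X3 := (_ - _ / _ + _).
have hX : 0 <= X1 + X2 + X3 * sq a.
  apply: addr_ge0; first by apply: addr_ge0; apply: sumr_ge0 => i _; exact: sq_ge0.
  apply: mulr_ge0; last exact: sq_ge0.
  rewrite /X3 addr_ge0 ?ler0n // subr_ge0 ler_pdivrMr ?ltr0n // -natrM ler_nat; lia.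
by rewrite [leRHS](_ : _ = X1 + X2 + X3 * sq a) //; rewrite /X1 /X2 /X3 /t /c; ring.
Qed.

(* Hyperplane on which the signless Laplacian of the target is below [5]. *)
Definition Ghyper (x : Gvert q s) : C :=
  match x with inl _ => (s + 2 * q).+1%:R | inr (inl _) => 1 | _ => 0 end.

(** On the hyperplane the cross terms between centre and cycle become -2(s + 2q + 1)|a|^2. The
    difference is then the sum of the |c_i - c_(i+1)|^2, of the |t_j + t'_j - a|^2 + 2|t_j -
    t'_j|^2, and of (s + q + 7)|a|^2. *)
Lemma Qform_Grel_lt (z : Gvert q s -> C) :
  (exists x, z x != 0) -> \sum_x Ghyper x * z x = 0 ->
  Qform (Grel q s) z < 5%:R * sqnorm z.
Proof.
move=> [x0 zx0]; rewrite sum_Gvert Qform_Grel /sqnorm sum_Gvert /=.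
under eq_bigr do rewrite mul1r.
rewrite [X in _ + (_ + X)]big1 ?addr0; last by move=> j _; rewrite !mul0r addr0.
set a := z ctr; pose c i := z (cyc i); pose t j b := z (tip j b).
rewrite -/c -/t => hyp.
have hc : \sum_i c i = - ((s + 2 * q).+1%:R * a) by apply/eqP; rewrite -addr_eq0 addrC hyp.
have hc' : \sum_i (c i)^* = - ((s + 2 * q).+1%:R * a^*).
  by rewrite -rmorph_sum hc rmorphN rmorphM /= rmorph_nat.
have e1 : \sum_i (sq (a + c i) + sq (c i + c (ordS i))) =
   \sum_i (5%:R * sq (c i)) + \sum_(i < s) sq a + a^* * (\sum_i c i) + (\sum_i (c i)^*) * a
   - \sum_i sq (c i - c (ordS i)).
  transitivity (\sum_i (sq (a + c i) + sq (c i + c (ordS i)) + 2%:R * sq (c i))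
                - \sum_i 2%:R * sq (c i)).
    by rewrite -sumrB; apply: eq_bigr => i _; ring.
  rewrite -[X in _ - X](sum_ordS (fun i => 2%:R * sq (c i))) mulr_sumr mulr_suml.
  rewrite -!big_split -!sumrB /=; apply: eq_bigr => i _.
  by rewrite !rmorphD !rmorphN /=; ring.
have e2 : \sum_j (sq (a + t j true) + sq (a + t j false) + sq (t j true + t j false)) =
  5%:R * (\sum_j (sq (t j true) + sq (t j false))) + \sum_(j < q) (3%:R * sq a)
  - \sum_j (sq (t j true + t j false - a) + 2%:R * sq (t j true - t j false)).
  rewrite mulr_sumr -big_split -sumrB /=; apply: eq_bigr => j _.
  by rewrite !rmorphD !rmorphN /=; ring.
rewrite e1 e2 hc hc' -subr_gt0 -mulr_sumr.
set X1 := \sum_i sq (c i - _); set X2 := \sum_j (sq (_ - a) + _).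
rewrite !sumr_const !card_ord -[(_ * _) *+ s]mulr_natl -[(_ * _) *+ q]mulr_natl.
have X1ge : 0 <= X1 by apply: sumr_ge0 => i _; exact: sq_ge0.
have X2ge : 0 <= X2 by apply: sumr_ge0 => i _; exact: sq2_ge0.
have X3ge : 0 <= (s + q + 7)%:R * sq a by apply: mulr_ge0; [exact: ler0n|exact: sq_ge0].
suff pos : 0 < X1 + X2 + (s + q + 7)%:R * sq a.
  rewrite [ltRHS](_ : _ = X1 + X2 + (s + q + 7)%:R * sq a) //.
  rewrite -(natr1 (s + 2 * q)%N) (natrD _ s (2 * q)%N) (natrM _ 2 q) (natrD _ (s + q)%N 7).
  by rewrite (natrD _ s q) /X1 /X2 /t /c; ring.
rewrite lt_def !addr_ge0 // andbT.
apply/negP; rewrite paddr_eq0 ?addr_ge0 //.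
rewrite paddr_eq0 // => /andP[/andP[/eqP X10 /eqP X20]].
rewrite mulf_eq0 pnatr_eq0 addnS /= mulf_eq0 conjC_eq0 orbb => /eqP a0.
(* All squares vanish: a = 0, [c] is constant with sum zero, and t_j = t'_j = -t'_j. *)
have cS i : c (ordS i) = c i.
  have /eqP := @psumr_eq0P _ _ _ _ (fun k _ => sq_ge0 _) X10 i isT.
  by rewrite mulf_eq0 conjC_eq0 orbb subr_eq0 => /eqP.
have c0 i : c i = 0.
  have s_gt0 : (0 < s)%N by lia.
  have cO m (ms : (m < s)%N) : c (Ordinal ms) = c (Ordinal s_gt0).
    elim: m ms => [|m IHm] ms; first by congr c; apply: val_inj.
    rewrite -(IHm (ltnW ms)) -(cS (Ordinal (ltnW ms))); congr c.
    by apply: val_inj; rewrite /= modn_small.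
  have ci j : c j = c i by case: i j => [i li] [j lj]; rewrite !cO.
  have := hc; rewrite a0 mulr0 oppr0; under eq_bigr do rewrite (ci _).
  rewrite sumr_const card_ord => /eqP; rewrite mulrn_eq0 => /orP[/eqP e|/eqP//].
  lia.
have t0 j : t j true = 0 /\ t j false = 0.
  have /eqP := @psumr_eq0P _ _ _ _ (fun k _ => sq2_ge0 _ _) X20 j isT.
  rewrite paddr_eq0 ?sq_ge0 //; last by apply: mulr_ge0; [exact: ler0n|exact: sq_ge0].
  rewrite a0 subr0.
  rewrite !mulf_eq0 !conjC_eq0 pnatr_eq0 !orbb /= addr_eq0 subr_eq0.
  move=> /andP[/eqP e1t /eqP e2t]; move: e1t; rewrite e2t => /eqP.
  by rewrite -addr_eq0 -mulr2n mulrn_eq0 => /eqP.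
case/negP: zx0; apply/eqP; case: x0 => [[]//|[i|[j []]]]; [exact: c0|exact: (t0 j).1|exact: (t0 j).2].
Qed.

(** * Explicit eigenfunctions of the target graph *)

Definition cycle_mode (r : C) (x : Gvert q s) : C :=
  match x with inr (inl i) => r ^+ i | _ => 0 end.

(** At the centre the equation says that the powers of a nontrivial s-th root of unity sum to zero;
    on the cycle the two neighbours contribute the factors r and 1/r. *)
Lemma cycle_mode_eigen r x : r ^+ s = 1 -> r != 1 ->
  Qop (Grel q s) (cycle_mode r) x = (3%:R + r + r^-1) * cycle_mode r x.
Proof.
move=> rs r1; have r0 : r != 0.
  by apply: contra_eq_neq rs => ->; rewrite expr0n gtn_eqF ?(ltn_trans _ s_ge3) // eq_sym oner_neq0.
case: x => [[]|[i|[j b]]]; rewrite /Qop.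
- rewrite nbr_sum_ctr mulr0 add0r mulr0 /= [X in _ + X]big1 ?addr0; last first.
    by move=> j _; rewrite ?addr0.
  have /eqP := subrX1 r s; rewrite rs subrr eq_sym mulf_eq0 subr_eq0 (negPf r1).
  by move=> /eqP.
- rewrite deg_cyc nbr_sum_cyc /= add0r !expr_mod //.
  have s0 : (0 < s)%N by lia.
  have -> : r ^+ (i + s).-1 = r^-1 * r ^+ i.
    apply: (mulfI r0); rewrite -exprS prednK ?addn_gt0 ?s0 ?orbT //.
    by rewrite exprD rs mulr1 mulrA divff // mul1r.
  by rewrite exprS !mulrDl addrA.
- by rewrite nbr_sum_tip /= !mulr0 addr0 addr0.
Qed.

Definition tip_mode (j : 'I_q) (x : Gvert q s) : C :=
  match x with inr (inr (k, b)) => (-1) ^+ b *+ (k == j) | _ => 0 end.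

Lemma tip_mode_eigen j x : Qop (Grel q s) (tip_mode j) x = tip_mode j x.
Proof.
case: x => [[]|[i|[k b]]]; rewrite /Qop.
- rewrite nbr_sum_ctr mulr0 add0r /= big1 ?add0r // big1 // => k _.
  by rewrite -mulrnDl expr0 expr1 addNr mul0rn.
- by rewrite nbr_sum_cyc /= mulr0 !addr0.
- rewrite deg_tip nbr_sum_tip /= add0r.
  by case: b; rewrite /= expr0 expr1 mulrnAr -mulrnDl; congr (_ *+ _); ring.
Qed.

Definition cycle_modes r (k : 'I_2) := if val k == 0%N then cycle_mode r else cycle_mode r^-1.

(** The values at the cycle vertices 0 and 1 already give a regular 2 by 2 system, since r and 1/r
    differ. *)
Lemma cycle_modes_free r (a : 'I_2 -> C) : r ^+ 2 != 1 -> r != 0 ->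
  (forall x, \sum_k a k * cycle_modes r k x = 0) -> forall k, a k = 0.
Proof.
move=> r2 r0 ha; have s0 : (0 < s)%N by lia.
have s1 : (1 < s)%N by lia.
have := ha (cyc (Ordinal s0)); have := ha (cyc (Ordinal s1)).
rewrite !big_ord_recl !big_ord0 /cycle_modes /= !expr0 !expr1 !mulr1 !addr0.
set a0 := a _; set a1 := a _ => h1 /eqP; rewrite addr_eq0 => /eqP h0.
have a10 : a1 = 0.
  move: h1; rewrite h0 mulNr addrC => /eqP; rewrite subr_eq0 => /eqP/(congr1 ( *%R^~ r)).
  rewrite mulfVK // -mulrA -expr2 => /eqP; rewrite -subr_eq0 -{1}[a1]mulr1 -mulrBr mulf_eq0.
  by rewrite subr_eq0 [1 == _]eq_sym (negPf r2) orbF => /eqP.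
move=> [[|[|//]] hk]; [rewrite -[RHS]oppr0 -a10 -h0|rewrite -a10]; congr a; exact: val_inj.
Qed.

Lemma tip_modes_free (a : 'I_q -> C) :
  (forall x, \sum_k a k * tip_mode k x = 0) -> forall k, a k = 0.
Proof.
move=> ha k; have := ha (tip k false); rewrite (bigD1 k) //= eqxx mulr1 big1 ?addr0 //.
by move=> j /negPf; rewrite eq_sym => ->; rewrite mulr0.
Qed.

(** For even [s] the alternating function on the cycle is an additional eigenfunction for 3 - 1 - 1
    = 1. *)
Definition even_modes (k : 'I_q.+1) :=
  if unlift ord_max k is Some j then tip_mode j else cycle_mode (-1).

Lemma even_modes_free (a : 'I_q.+1 -> C) :
  (forall x, \sum_k a k * even_modes k x = 0) -> forall k, a k = 0.
Proof.
move=> ha.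
have E x : a ord_max * cycle_mode (-1) x + \sum_j a (lift ord_max j) * tip_mode j x = 0.
  rewrite -[RHS](ha x) big_ord_recr [RHS]addrC /=; congr (_ + _).
    by rewrite /even_modes unlift_none.
  apply: eq_bigr => j _; rewrite /even_modes.
  have -> : widen_ord (leqnSn q) j = lift ord_max j.
    by apply: val_inj; rewrite /= /bump leqNgt ltn_ord.
  by rewrite liftK.
have a0 j : a (lift ord_max j) = 0.
  have := E (tip j false); rewrite mulr0 add0r (bigD1 j) //= eqxx mulr1 big1 ?addr0 //.
  by move=> i /negPf; rewrite eq_sym => ->; rewrite mulr0.
move=> k; case: (unliftP ord_max k) => [j ->|->]; first exact: a0.
have s0 : (0 < s)%N by lia.
by have := E (cyc (Ordinal s0)); rewrite /= big1 ?addr0 ?mulr1 // => j _; rewrite mulr0.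
Qed.

Lemma even_modes_eigen k x : ~~ odd s ->
  Qop (Grel q s) (even_modes k) x = even_modes k x.
Proof.
move=> se; rewrite /even_modes; case: unlift => [j|]; first exact: tip_mode_eigen.
rewrite cycle_mode_eigen; last by rewrite eq_sym -addr_eq0 -mulr2n pnatr_eq0.
  by rewrite invrN1 -[RHS]mul1r; congr (_ * _); ring.
by rewrite -signr_odd (negPf se).
Qed.

End Target.

(** * Degrees *)

Section Degrees.
Variables (C : numClosedFieldType) (T : finType) (e : rel T).
Hypothesis g : simple_graph e.
Implicit Types (P R : {set T}) (a b : C).

Definition nbrs_in P x : nat := \sum_(y | e x y) (y \in P).

Definition two_step P R a b (x : T) : C := a * (x \in P)%:R + b * (x \in R)%:R.

Lemma sqnorm_two_step P R a b : [disjoint P & R] ->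
  sqnorm (two_step P R a b) = a^* * a * #|P|%:R + b^* * b * #|R|%:R.
Proof.
move=> PR; rewrite /sqnorm -!sum1_card !natr_sum !mulr_sumr.
rewrite [X in _ = X + _]big_mkcond [X in _ = _ + X]big_mkcond -big_split /=.
apply: eq_bigr => x _; rewrite /two_step.
case xP : (x \in P); first rewrite (disjointFr PR xP).
  by rewrite !mulr1 !mulr0 !addr0.
by case: (x \in R); rewrite !(mulr0, mulr1, add0r, addr0).
Qed.

Lemma edges_between_sym P R :
  (\sum_(x in P) nbrs_in R x = \sum_(x in R) nbrs_in P x)%N.
Proof.
rewrite big_mkcond [RHS]big_mkcond /=.
transitivity (\sum_x \sum_y (e x y && (x \in P) && (y \in R) : nat))%N.
  apply: eq_bigr => x _; rewrite /nbrs_in big_mkcond; case: (x \in P) => /=.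
    by apply: eq_bigr => y _; case: (e x y).
  by rewrite big1 // => y _; rewrite andbF.
rewrite exchange_big /=; apply: eq_bigr => x _; rewrite /nbrs_in [in RHS]big_mkcond.
case: (x \in R) => /=; last by rewrite big1 // => y _; rewrite andbF.
by apply: eq_bigr => y _; rewrite (proj1 g) andbT; case: (e x y).
Qed.

Lemma Qform_two_step P R a b : [disjoint P & R] ->
  Qform e (two_step P R a b) =
    a^* * a * (\sum_(x in P) (deg e x + nbrs_in P x))%:R +
    b^* * b * (\sum_(x in R) (deg e x + nbrs_in R x))%:R +
    (a^* * b + b^* * a) * (\sum_(x in P) nbrs_in R x)%:R.
Proof.
move=> PR; rewrite mulrDl {2}edges_between_sym !natr_sum !mulr_sumr.
rewrite [X in _ = X + _ + _]big_mkcond [X in _ = _ + X + _]big_mkcond /=.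
rewrite [X in _ = _ + (X + _)]big_mkcond [X in _ = _ + (_ + X)]big_mkcond /=.
rewrite -!big_split /=; apply: eq_bigr => x _; rewrite /Qop.
have -> : \sum_(y | e x y) two_step P R a b y =
    a * (nbrs_in P x)%:R + b * (nbrs_in R x)%:R.
  by rewrite /nbrs_in !natr_sum !mulr_sumr -big_split.
rewrite /two_step !natrD.
case xP : (x \in P); first rewrite (disjointFr PR xP).
  by rewrite !mulr1 !mulr0 !addr0; ring.
case: (x \in R); rewrite !(mulr0, mulr1, add0r, addr0); first by ring.
by rewrite rmorph0 mul0r.
Qed.

Section Spectrum.
Hypothesis Qge1 : forall z : T -> C, sqnorm z <= Qform e z.
Variable l : T -> C.
Hypothesis Qlt5 : forall z : T -> C, (exists x, z x != 0) ->
  \sum_x l x * z x = 0 -> Qform e z < 5%:R * sqnorm z.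

(** The plane spanned by the two indicator functions meets the hyperplane of [Qlt5]. On it, Q - 5 is
    the Hermitian form with diagonal entries A, G and off-diagonal entry B; the last three
    hypotheses make it positive semidefinite, against [Qlt5]. *)
Lemma two_sets P R : [disjoint P & R] -> P != set0 -> R != set0 ->
  (5 * #|P| <= \sum_(x in P) (deg e x + nbrs_in P x))%N ->
  (5 * #|R| <= \sum_(x in R) (deg e x + nbrs_in R x))%N ->
  ((\sum_(x in P) nbrs_in R x) ^ 2 <=
     (\sum_(x in P) (deg e x + nbrs_in P x) - 5 * #|P|) *
     (\sum_(x in R) (deg e x + nbrs_in R x) - 5 * #|R|))%N -> False.
Proof.
move=> PR /set0Pn[p pP] /set0Pn[r rR] hP hR.
set A := (_ - 5 * #|P|)%N; set G := (_ - 5 * #|R|)%N; set B := (\sum_(x in P) _)%N => hB.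
pose LP := \sum_(x in P) l x; pose LR := \sum_(x in R) l x.
(* A nonzero solution of the single equation that puts a 1_P + b 1_R into the hyperplane. *)
have [a [b [ab0 abL]]] : exists a b, (a != 0) || (b != 0) /\ a * LP + b * LR = 0.
  have [e0|n0] := eqVneq LR 0.
    have [e1|n1] := eqVneq LP 0; first by exists 1, 0; rewrite oner_eq0 e1 mulr0 mul0r addr0.
    by exists 0, 1; rewrite oner_eq0 orbT e0 mulr0 mul0r addr0.
  by exists LR, (- LP); rewrite n0; split=> //; ring.
pose z := two_step P R a b.
have z0 : exists x, z x != 0.
  case/orP: ab0 => [a0|b0].
    by exists p; rewrite /z /two_step pP (disjointFr PR pP) mulr0 mulr1 addr0.
  by exists r; rewrite /z /two_step rR (disjointFl PR rR) mulr0 mulr1 add0r.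
have lz : \sum_x l x * z x = 0.
  rewrite -[RHS]abL /LP /LR !mulr_sumr [X in _ = X + _]big_mkcond [X in _ = _ + X]big_mkcond.
  rewrite -big_split /=; apply: eq_bigr => x _; rewrite /z /two_step.
  by case: (x \in P); case: (x \in R); rewrite !(mulr0, mulr1, add0r, addr0); ring.
have := Qlt5 z0 lz; rewrite -subr_lt0 sqnorm_two_step // Qform_two_step //.
rewrite -/B; set hp := (\sum_(x in P) _)%N in hP A hB *.
set hr := (\sum_(x in R) _)%N in hR G hB *.
have -> : hp = (A + 5 * #|P|)%N by rewrite /A subnK.
have -> : hr = (G + 5 * #|R|)%N by rewrite /G subnK.
rewrite (natrD _ A) (natrD _ G) !(natrM _ 5).
set X := (X in X < 0).
have -> : X = a^* * a * A%:R + b^* * b * G%:R + (a^* * b + b^* * a) * B%:R.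
  by rewrite /X; ring.
move=> neg; have := neg; have [A0|A0] := posnP A.
  have B0 : B = 0%N by move: hB; rewrite -/A A0 mul0n leqn0 expn_eq0 => /andP[/eqP].
  rewrite A0 B0 !mulr0 addr0 add0r => /lt_geF; rewrite mulr_ge0 ?ler0n //.
  exact: sq_ge0.
have A0' : 0 < A%:R :> C by rewrite ltr0n.
(* Multiplied by A, the form is |A a + B b|^2 + (A G - B^2)|b|^2. *)
rewrite -(pmulr_rlt0 _ A0') => /lt_geF.
have -> : A%:R * (a^* * a * A%:R + b^* * b * G%:R + (a^* * b + b^* * a) * B%:R) =
  (A%:R * a + B%:R * b)^* * (A%:R * a + B%:R * b) + (A * G - B ^ 2)%:R * (b^* * b).
  rewrite (natrB _ hB).
  by rewrite natrM natrX !rmorphD !rmorphM /= !rmorph_nat; ring.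
rewrite addr_ge0 //; first exact: sq_ge0.
apply: mulr_ge0; [exact: ler0n|exact: sq_ge0].
Qed.

Lemma nbrs_in1 y x : nbrs_in [set y] x = e x y :> nat.
Proof.
rewrite /nbrs_in big_mkcond (bigD1 y) //= inE eqxx big1 ?addn0; first by case: (e x y).
by move=> u /negPf uy; rewrite inE uy; case: ifP.
Qed.

Lemma deg_ge2 x : (2 <= deg e x)%N.
Proof.
rewrite leqNgt; apply/negP; rewrite ltnS leq_eqVlt ltnS leqn0 => /orP[/eqP d1|/eqP d0].
  have /set0Pn[y] : [set y | e x y] != set0 by rewrite -card_gt0 cardsE -/(deg e x) d1.
  rewrite inE => exy.
  have yx : y != x by apply: contraTneq exy => ->; rewrite (proj2 g).
  have dis : [disjoint [set x] & [set y]] by rewrite disjoints1 inE eq_sym.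
  (* For a leaf x whose neighbour y has degree d, the function d 1_x - 1_y has form minus squared
     norm equal to -(1 + d). *)
  have := Qge1 (two_step [set x] [set y] (deg e y)%:R (-1)).
  rewrite sqnorm_two_step // Qform_two_step // !big_set1 !cards1 !nbrs_in1 !(proj2 g) exy d1.
  rewrite rmorphN rmorph1 !rmorph_nat !addn0 /=; set d := deg e y; rewrite -subr_ge0.
  rewrite [leRHS](_ : _ = - (1 + d%:R)); last by ring.
  by rewrite oppr_ge0 => /le_gtF; rewrite ltr_wpDr ?ltr01 ?ler0n.
have dis : [disjoint [set x] & (set0 : {set T})] by rewrite -setI_eq0 setI0.
have := Qge1 (two_step [set x] set0 1 0).
rewrite sqnorm_two_step // Qform_two_step // !big_set1 !big_set0 !cards1 cards0 nbrs_in1.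
have -> : nbrs_in set0 x = 0%N by rewrite /nbrs_in big1 // => y _; rewrite inE.
by rewrite (proj2 g) d0 rmorph1 rmorph0 !(mulr0, mulr1, addr0, mul0r) ler10.
Qed.

Lemma deg_lt_card x : (deg e x < #|T|)%N.
Proof.
rewrite -cardsT (cardsD1 x) inE add1n ltnS /deg -cardsE subset_leq_card //.
by apply/subsetP=> y; rewrite !inE andbT => exy; apply: contraTneq exy => ->; rewrite (proj2 g).
Qed.

Lemma full_deg x : deg e x = #|T|.-1 -> forall y, y != x -> e x y.
Proof.
move=> dx y yx.
have sub : [set y | e x y] \subset [set~ x].
  by apply/subsetP=> u; rewrite !inE => exu; apply: contraTneq exu => ->; rewrite (proj2 g).
have /eqP E : [set y | e x y] == [set~ x].
  by rewrite eqEcard sub cardsC1 cardsE -/(deg e x) dx leqnn.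
by have : y \in [set~ x] by [rewrite !inE]; rewrite -E inE.
Qed.

Lemma degrees q s : #|T| = (s + 2 * q).+1 -> (15 <= s + 2 * q)%N ->
  (\sum_x deg e x = (s + 2 * q) + 3 * s + 4 * q)%N ->
  (\sum_x deg e x ^ 2 = (s + 2 * q) ^ 2 + 9 * s + 8 * q)%N ->
  exists c, [/\ forall x, x != c -> e c x,
    forall x, x != c -> deg e x = 2 \/ deg e x = 3 &
    (\sum_(x | x != c) deg e x = 3 * s + 4 * q)%N].
Proof.
move=> cT N15 S1 S2.
have /card_gt0P[x0 _] : (0 < #|T|)%N by rewrite cT.
have [c _ cmax] := @arg_maxnP T x0 predT (deg e) isT.
(* Otherwise [x] and [c] both exceed 5 by at least 1, while the off-diagonal entry is at most 1. *)
have d5 x : x != c -> (deg e x <= 5)%N.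
  move=> xc; rewrite leqNgt; apply/negP=> d6.
  have dc : (deg e x <= deg e c)%N by apply: cmax.
  apply: (@two_sets [set c] [set x]).
  - by rewrite disjoints1 inE eq_sym.
  - by apply/set0Pn; exists c; rewrite inE.
  - by apply/set0Pn; exists x; rewrite inE.
  - by rewrite big_set1 cards1; lia.
  - by rewrite big_set1 cards1; lia.
  - rewrite !big_set1 !cards1 !nbrs_in1 !(proj2 g) !addn0.
    apply: (@leq_trans 1); first by case: (e c x).
    by rewrite muln_gt0 !subn_gt0; lia.
have A0 : (\sum_(x | x != c) 1 = s + 2 * q)%N.
  have := cardsC1 c; rewrite cT /= => <-; rewrite sum1_card -cardsE.
  by apply: eq_card => x; rewrite !inE.
move: S1 S2; rewrite (bigD1 c) //= => S1; rewrite (bigD1 c) //= => S2; move: S1 S2.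
set A1 := (\sum_(x | _) deg e x)%N; set A2 := (\sum_(x | _) deg e x ^ 2)%N.
pose B5 := (\sum_(x | x != c) (deg e x == 5))%N.
(* Pointwise, (d - 2)(d - 4) is at most 0 for d = 2, 3, 4 and equals 3 for d = 5. *)
have ineq : (A2 + 8 * (s + 2 * q) <= 6 * A1 + 3 * B5)%N.
  rewrite -A0 /A1 /B5 !big_distrr -!big_split /=; apply: leq_sum => x xc.
  have := deg_ge2 x; have := d5 x xc; case: (deg e x) => [|[|[|[|[|[|[]]]]]]] //.
have B5le : (B5 <= s + 2 * q)%N by rewrite -A0; apply: leq_sum => x _; case: eqP.
move=> S1 S2.
(* With N = s + 2q and [B5 <= N], a largest degree of at most 6 would give N^2 <= 10 N. *)
have dc7 : (7 <= deg e c)%N by rewrite leqNgt; apply/negP => dc; nia.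
(* Let x and y have degree 5. If they are adjacent, the pair has excess 2 and sends at most 2 edges
   to [c], whose excess is at least 2 by [dc7]. If not, the form on {x} and {y} is zero. *)
have B51 : (B5 <= 1)%N.
  have -> : B5 = #|[set x | (x != c) && (deg e x == 5)]|.
    rewrite -sum1_card /B5 big_mkcond [RHS]big_mkcond; apply: eq_bigr => x _.
    by rewrite inE; case: (x != c); case: eqP.
  rewrite leqNgt; apply/negP=> /card_gt1P[x [y []]]; rewrite !inE.
  move=> /andP[xc /eqP dx] /andP[yc /eqP dy] xy.
  have [exy|nexy] := boolP (e x y).
    have cxy : c \notin [set x; y] by rewrite !inE negb_or !(eq_sym c) xc yc.
    have nx : nbrs_in [set x; y] x = 1%N.
      rewrite /nbrs_in (bigD1 y) //= !inE eqxx orbT big1 // => u /andP[exu /negPf uy].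
      by rewrite !inE uy orbF; case: eqP exu => // ->; rewrite (proj2 g).
    have ny : nbrs_in [set x; y] y = 1%N.
      rewrite /nbrs_in (bigD1 x) /= 1?(proj1 g) // !inE eqxx big1 // => u /andP[exu /negPf uy].
      by rewrite !inE uy /=; case: eqP exu => // ->; rewrite (proj2 g).
    have nc : (nbrs_in [set x; y] c <= 2)%N.
      have <- : #|[set x; y]| = 2%N by rewrite cards2 xy.
      rewrite -sum1_card /nbrs_in big_mkcond [X in (_ <= X)%N]big_mkcond /=.
      by apply: leq_sum => u _; case: (e c u); case: (u \in _).
    have sP F : (\sum_(u in [set x; y]) F u = F x + F y)%N.
      by rewrite (big_setD1 x) ?inE ?eqxx //= setU1K ?big_set1 // inE xy.
    apply: (@two_sets [set c] [set x; y]).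
    - by rewrite disjoints1.
    - by apply/set0Pn; exists c; rewrite inE.
    - by apply/set0Pn; exists x; rewrite !inE eqxx.
    - by rewrite big_set1 cards1; lia.
    - by rewrite sP cards2 xy nx ny dx dy.
    - rewrite sP cards2 xy nx ny dx dy !big_set1 cards1 nbrs_in1 (proj2 g); nia.
  apply: (@two_sets [set x] [set y]).
  - by rewrite disjoints1 inE.
  - by apply/set0Pn; exists x; rewrite inE.
  - by apply/set0Pn; exists y; rewrite inE.
  - by rewrite big_set1 cards1 dx; lia.
  - by rewrite big_set1 cards1 dy; lia.
  - by rewrite !big_set1 nbrs_in1 (negPf nexy).
have dcle := deg_lt_card c; rewrite cT ltnS in dcle.
(* With d the degree of [c] and N = s + 2q, [ineq] and [B51] give (N - d)(N + d - 6) <= s + 3, which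
   fails for 7 <= d < N. *)
have dcN : deg e c = (s + 2 * q)%N.
  apply/eqP; rewrite eqn_leq dcle leqNgt; apply/negP=> dcl; nia.
exists c; split.
- by apply: full_deg; rewrite dcN cT.
(* The sum of (d - 2)(d - 3) over the vertices other than [c] is zero, and no term is negative at an
   integer d. *)
- have eqs : (\sum_(x | x != c) (deg e x ^ 2 + 6) = \sum_(x | x != c) 5 * deg e x)%N.
    rewrite big_split /= -big_distrr /= -/A1 -/A2.
    have -> : (\sum_(x | x != c) 6 = 6 * (s + 2 * q))%N by rewrite -A0 big_distrr.
    nia.
  move=> x xc.
  have le5 y : y != c -> (5 * deg e y <= deg e y ^ 2 + 6)%N.
    move=> yc; have := deg_ge2 y; have := d5 y yc.
    by case: (deg e y) => [|[|[|[|[|[|[]]]]]]].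
  have : (deg e x ^ 2 + 6 <= 5 * deg e x)%N.
    have lerest : (\sum_(i | (i != c) && (i != x)) 5 * deg e i <=
              \sum_(i | (i != c) && (i != x)) (deg e i ^ 2 + 6))%N.
      by apply: leq_sum => i /andP[ic _]; apply: le5.
    move: eqs; rewrite (bigD1 x) //= [RHS](bigD1 x) //=; lia.
  have := deg_ge2 x; have := d5 x xc.
  by case: (deg e x) => [|[|[|[|[|[|[]]]]]]] //; auto.
- by move: S1; rewrite dcN -/A1; lia.
Qed.

End Spectrum.
End Degrees.

(** * Eigenfunctions on paths and cycles *)

Lemma flatten_uniq_inj (T : eqType) (ss : seq (seq T)) i j x :
  uniq (flatten ss) -> x \in nth [::] ss i -> x \in nth [::] ss j -> i = j.
Proof.
elim: ss i j => [|a ss IHs] i j /=; first by rewrite !nth_nil.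
have sub k : x \in nth [::] ss k -> x \in flatten ss.
  move=> xk; apply/flattenP; exists (nth [::] ss k) => //; apply: mem_nth.
  by rewrite ltnNge; apply: contraTN xk => h; rewrite nth_default.
rewrite cat_uniq => /and3P[_ /hasPn h u].
case: i j => [|i] [|j] //=.
- by move=> xa /sub/h; rewrite xa.
- by move=> /sub/h; move/negPf=> xa; rewrite xa.
- by move=> xi xj; congr _.+1; apply: IHs.
Qed.

Lemma flatten_uniq_uniq (T : eqType) (ss : seq (seq T)) :
  uniq (flatten ss) -> [::] \notin ss -> uniq ss.
Proof.
move=> u n0; apply/(uniqP [::]) => i j; rewrite !inE => ii jj eij.
case E : (nth [::] ss i) => [|x a]; first by case/negP: n0; rewrite -E mem_nth.
by apply: (@flatten_uniq_inj _ ss i j x) => //; rewrite -?eij E mem_head.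
Qed.

Lemma mem_rem_neq (I : eqType) (s : seq I) a x : x \in s -> x != a -> x \in rem a s.
Proof.
move=> xs xa; case as_ : (a \in s); last by rewrite rem_id // as_.
by move: xs; rewrite (perm_mem (perm_to_rem as_)) inE (negPf xa).
Qed.

Lemma sum_subseq_le (I : eqType) (F : I -> nat) (l s : seq I) :
  uniq l -> {subset l <= s} -> (\sum_(i <- l) F i <= \sum_(i <- s) F i)%N.
Proof.
elim: l s => [|a l IHl] s; first by rewrite big_nil.
rewrite /= => /andP[al ul] sub; have as_ : a \in s by apply: sub; rewrite mem_head.
rewrite big_cons [X in (_ <= X)%N](big_rem a) //= leq_add2l; apply: IHl => // x xl.
by apply: mem_rem_neq; [apply: sub; rewrite inE xl orbT|apply: contraTneq xl => ->].
Qed.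

Section Sequences.
Variable C : numClosedFieldType.

Section PathSeq.
Variables (u : nat -> C) (k : nat) (r : C).
Hypotheses (k2 : (1 < k)%N) (r0 : r != 0).
Hypothesis u0 : u 0%N + u 1%N = (2%:R + r + r^-1) * u 0%N.
Hypothesis ui : forall i, (i.+2 < k)%N ->
  2%:R * u i.+1 + u i + u i.+2 = (2%:R + r + r^-1) * u i.+1.

(* The solution is u_i = u_0 (r^(i+1) - r^(-i)) / (r - 1); it is stated multiplied
   out so that it also holds for r = 1. *)
Lemma path_seqE i : (i < k)%N -> r ^+ i * (r - 1) * u i = u 0%N * (r ^+ i.*2.+1 - 1).
Proof.
have H : forall i, (i.+1 < k)%N ->
    (r ^+ i * (r - 1) * u i = u 0%N * (r ^+ i.*2.+1 - 1)) /\
    (r ^+ i.+1 * (r - 1) * u i.+1 = u 0%N * (r ^+ i.+1.*2.+1 - 1)).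
  elim=> [_|j IHj jk].
    split; first by rewrite expr0 expr1; ring.
    have -> : u 1%N = (1 + r + r^-1) * u 0%N by apply: (addrI (u 0%N)); rewrite u0; ring.
    by rewrite (_ : 1.*2.+1 = 3)%N // expr1; field.
  have [h1 h2] := IHj (ltnW jk).
  split=> //; have -> : u j.+2 = (r + r^-1) * u j.+1 - u j.
    by apply: (addrI (2%:R * u j.+1 + u j)); rewrite ui //; ring.
  have -> : r ^+ j.+2 * (r - 1) * ((r + r^-1) * u j.+1 - u j) =
      (r ^+ 2 + 1) * (r ^+ j.+1 * (r - 1) * u j.+1) - r ^+ 2 * (r ^+ j * (r - 1) * u j).
    by rewrite !exprS; field.
  by rewrite h1 h2 !doubleS !exprS; ring.
case: i => [_|i ik]; first by rewrite expr0 expr1; ring.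
by case: (H i ik).
Qed.

(** Summation of the closed form. For r different from 0 and 1, the total over the path vanishes
    only if u_0 = 0 or r^k = 1. *)
Lemma path_seq_sum i : (i <= k)%N ->
  r ^+ i * (r - 1) ^+ 2 * (\sum_(j < i) u j) = r * u 0%N * (r ^+ i - 1) ^+ 2.
Proof.
elim: i => [_|i IHi ik]; first by rewrite big_ord0 expr0; ring.
rewrite big_ord_recr /= exprS.
have -> : r * r ^+ i * (r - 1) ^+ 2 * (\sum_(j < i) u j + u i) =
   r * (r ^+ i * (r - 1) ^+ 2 * (\sum_(j < i) u j)) +
   r * (r - 1) * (r ^+ i * (r - 1) * u i) by ring.
rewrite IHi ?path_seqE //; last by lia.
by rewrite (exprS r i.*2) -muln2 exprM; ring.
Qed.

(** Inserting the closed form into the equation at the last vertex gives u_0 (1 + r)(r^(2k) - 1) =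
    0. *)
Lemma path_seq_period : r != 1 -> r != -1 -> u 0%N != 0 ->
  u k.-1 + u k.-2 = (2%:R + r + r^-1) * u k.-1 -> r ^+ (2 * k) = 1.
Proof.
move=> r1 rN1 u00 ul.
have e1 := @path_seqE k.-1 _; have e2 := @path_seqE k.-2 _.
move: e1 e2; have -> : k.-1 = k.-2.+1 by lia.
move: ul; have -> : k.-1 = k.-2.+1 by lia.
have -> : (2 * k = k.-2.*2.+4)%N by lia.
set j := k.-2 => ul e1 e2; have {}e1 := e1 ltac:(lia); have {}e2 := e2 ltac:(lia).
have ul' : u j = (1 + r + r^-1) * u j.+1 by apply: (addrI (u j.+1)); rewrite ul; ring.
have E : (1 + r + r^-1) * r ^+ j.+1 * (r - 1) * u j.+1 = r * (r ^+ j * (r - 1) * u j).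
  by rewrite ul' exprS; ring.
have E2 : (1 + r + r^-1) * (u 0%N * (r ^+ j.+1.*2.+1 - 1)) = r * (u 0%N * (r ^+ j.*2.+1 - 1)).
  by rewrite -e2 -E -e1; ring.
have : u 0%N * (1 + r) * (r ^+ j.*2.+4 - 1) = 0.
  transitivity (r * ((1 + r + r^-1) * (u 0%N * (r ^+ j.+1.*2.+1 - 1))
     - r * (u 0%N * (r ^+ j.*2.+1 - 1)))); last by rewrite E2 subrr mulr0.
  by rewrite doubleS !exprS; field.
move/eqP; rewrite !mulf_eq0 (negPf u00) addrC addr_eq0 (negPf rN1) subr_eq0.
by move/eqP.
Qed.

End PathSeq.

(** The second-order recursion factors: w_i = u_(i+1) - r u_i satisfies w_i = r w_(i+1). Periodicity
    and r^k != 1 give w = 0; then u_(i+1) = r u_i, and the same argument gives u = 0. *)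
Lemma cycle_seq0 (u : nat -> C) k r : (0 < k)%N -> r != 0 -> (forall i, u (i + k)%N = u i) ->
  (forall i, 2%:R * u i.+1 + u i + u i.+2 = (2%:R + r + r^-1) * u i.+1) ->
  r ^+ k != 1 -> forall i, u i = 0.
Proof.
move=> k0 r0 uper ui rk.
have wS i : u i.+1 - r * u i = r * (u i.+2 - r * u i.+1).
  have -> : u i.+2 = (r + r^-1) * u i.+1 - u i.
    by apply: (addrI (2%:R * u i.+1 + u i)); rewrite ui; ring.
  by field.
have wk i m : u i.+1 - r * u i = r ^+ m * (u (m + i).+1 - r * u (m + i)%N).
  elim: m => [|m IHm]; first by rewrite expr0 mul1r.
  by rewrite IHm wS exprS addSn; ring.
have w0 i : u i.+1 = r * u i.
  have := wk i k; rewrite -addnS addnC uper [(k + i)%N]addnC uper => /eqP.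
  rewrite -subr_eq0 -{1}[u i.+1 - _]mul1r -mulrBl mulf_eq0 subr_eq0 eq_sym (negPf rk) /=.
  by rewrite subr_eq0 => /eqP.
have wm i m : u (m + i)%N = r ^+ m * u i.
  elim: m => [|m IHm]; first by rewrite mul1r.
  by rewrite addSn w0 IHm exprS mulrA.
move=> i; have := wm i k; rewrite addnC uper => /eqP.
rewrite -subr_eq0 -{1}[u i]mul1r -mulrBl mulf_eq0 subr_eq0 eq_sym (negPf rk) /=.
by move/eqP.
Qed.

Section PathOne.
Variables (u : nat -> C) (k : nat) (b : C).
Hypothesis k2 : (1 < k)%N.
Hypothesis u0 : u 0%N + u 1%N = - b.
Hypothesis ui : forall i, (i.+2 < k)%N -> 2%:R * u i.+1 + u i + u i.+2 = - b.

(** Each equation is the sum of two consecutive pair sums, so the pair sums alternate between -b and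
    0. *)
Lemma path_one_pair i : (i.+1 < k)%N -> u i + u i.+1 = - (~~ odd i)%:R * b.
Proof.
elim: i => [_|i IHi ik]; first by rewrite u0 mulN1r.
have := ui ik; have := IHi (ltnW ik) => h1 h2.
have -> : u i.+1 + u i.+2 = - b - (u i + u i.+1) by rewrite -h2; ring.
by rewrite h1 /=; case: (odd i) => /=; ring.
Qed.

(** For odd [k] the last pair sum is 0 by alternation and -b by the end equation. *)
Lemma path_one_odd : odd k -> u k.-1 + u k.-2 = - b -> b = 0.
Proof.
move=> ko ul; have := @path_one_pair k.-2; rewrite -[k.-2.+1](_ : k.-1 = _); last by lia.
rewrite addrC ul => /(_ ltac:(lia)).
have -> : odd k.-2 by lia.
by rewrite oppr0 mul0r => /eqP; rewrite oppr_eq0 => /eqP.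
Qed.

Lemma path_one_sum j : (j.*2 <= k)%N -> \sum_(i < j.*2) u i = - j%:R * b.
Proof.
elim: j => [_|j IHj jk]; first by rewrite big_ord0; ring.
rewrite doubleS !big_ord_recr /= IHj; last by lia.
rewrite -addrA path_one_pair ?odd_double; last by lia.
by rewrite -natr1 /=; ring.
Qed.

End PathOne.
End Sequences.

(** * Neighbour sums and degree sums inside a component *)

Section ComponentSums.
Variables (T : finType) (f : rel T) (x0 : T).

Lemma path_nbr_sum (R : nmodType) (F : T -> R) p i : path_comp f p -> (i < size p)%N ->
  \sum_(y | f (nth x0 p i) y) F y =
  (if (0 < i)%N then F (nth x0 p i.-1) else 0) +
  (if (i.+1 < size p)%N then F (nth x0 p i.+1) else 0).
Proof.
case=> k2 up fp ip; under eq_bigl do rewrite fp //.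
case: posnP => [i0|i0]; case: ltnP => ik /=.
- by rewrite add0r; apply: big_pred1.
- by lia.
- rewrite (bigD1 (nth x0 p i.-1)) /= ?eqxx //; congr (_ + _); apply: big_pred1 => y /=.
  have [->|] := eqVneq y (nth x0 p i.+1); last by rewrite orbF andbN.
  rewrite orbT nth_uniq //; last exact: leq_ltn_trans (leq_pred _) ip.
  by apply/eqP => ei; rewrite -(prednK i0) in ei; lia.
- by rewrite addr0; apply: big_pred1 => y; rewrite /= orbF.
Qed.

Lemma cycle_nbr_sum (R : nmodType) (F : T -> R) p i : cycle_comp f p -> (i < size p)%N ->
  \sum_(y | f (nth x0 p i) y) F y =
  F (nth x0 p (i.+1 %% size p)) + F (nth x0 p ((i + size p).-1 %% size p)).
Proof.
case=> k3 up fp ip; under eq_bigl do rewrite fp //.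
rewrite (bigD1 (nth x0 p (i.+1 %% size p))) /= ?eqxx //; congr (_ + _).
apply: big_pred1 => y /=.
have [->|] := eqVneq y (nth x0 p ((i + size p).-1 %% size p)); last by rewrite orbF andbN.
rewrite orbT nth_uniq ?ltn_pmod //; try lia.
have [i0|i0] := posnP i; first by rewrite i0 add0n !modn_small; lia.
have -> : ((i + size p).-1 = i.-1 + size p)%N by lia.
rewrite modnDr (@modn_small i.-1); last by lia.
have [ik|ik] := ltnP i.+1 (size p); first by rewrite modn_small; lia.
have -> : (i.+1 = size p)%N by lia.
by rewrite modnn; lia.
Qed.

Lemma path_deg p i : path_comp f p -> (i < size p)%N ->
  deg f (nth x0 p i) = ((0 < i) + (i.+1 < size p))%N.
Proof.
move=> pc ip; rewrite degE (@path_nbr_sum nat (fun=> 1%N) p i pc ip).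
by case: (0 < i)%N; case: (i.+1 < size p)%N.
Qed.

Lemma cycle_deg p i : cycle_comp f p -> (i < size p)%N -> deg f (nth x0 p i) = 2.
Proof. by move=> pc ip; rewrite degE (@cycle_nbr_sum nat (fun=> 1%N) p i pc ip). Qed.

Lemma path_deg_sum p : path_comp f p -> (\sum_(x <- p) deg f x = 2 * (size p - 1))%N.
Proof.
move=> pc; have [k2 _ _] := pc; rewrite (big_nth x0) big_mkord.
under eq_bigr => i _ do rewrite path_deg //.
rewrite big_split /=.
have -> : (\sum_(i < size p) (0 < i) = size p - 1)%N.
  case: (size p) k2 => // k _; rewrite big_ord_recl /= add0n.
  by rewrite sum_nat_const card_ord; lia.
have -> : (\sum_(i < size p) (i.+1 < size p) = size p - 1)%N.
  case: (size p) k2 => // k _; rewrite big_ord_recr /= ltnn addn0.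
  rewrite (eq_bigr (fun=> 1%N)); first by rewrite sum_nat_const card_ord; lia.
  by move=> i _; rewrite ltnS ltn_ord.
by lia.
Qed.

Lemma cycle_deg_sum p : cycle_comp f p -> (\sum_(x <- p) deg f x = 2 * size p)%N.
Proof.
move=> pc; rewrite (big_nth x0) big_mkord.
under eq_bigr => i _ do rewrite cycle_deg //.
by rewrite sum_nat_const card_ord mulnC.
Qed.

End ComponentSums.

(** * Eigenfunctions of a graph with a dominating vertex *)

Section Core.
Variables (C : numClosedFieldType) (T : finType) (e : rel T) (c : T).
Hypotheses (g : simple_graph e) (full : forall x, x != c -> e c x).

(** Deletion of the centre on the same vertex type: [c] stays as an isolated vertex. *)
Definition off : rel T := fun x y => [&& e x y, x != c & y != c].

Lemma off_sym : symmetric off.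
Proof. by move=> x y; rewrite /off (proj1 g) [(x != c) && _]andbC. Qed.

Lemma off_irr : irreflexive off.
Proof. by move=> x; rewrite /off (proj2 g). Qed.

Lemma nbr_sum_off (R : nmodType) (F : T -> R) x : x != c ->
  \sum_(y | e x y) F y = F c + \sum_(y | off x y) F y.
Proof.
move=> xc; rewrite (bigD1 c) /=; last by rewrite (proj1 g) full.
by congr (_ + _); apply: eq_bigl => y; rewrite /off xc.
Qed.

Lemma deg_off x : x != c -> deg e x = (deg off x).+1.
Proof. by move=> xc; rewrite !degE (@nbr_sum_off nat (fun=> 1%N) x xc). Qed.

Section Eigen.
Variables (v : T -> C) (lam : C).
Hypothesis veig : forall x, Qop e v x = lam * v x.

(** The spoke to the centre adds 1 to the degree and [v c] to the neighbour sum, whence the shifted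
    eigenvalue and the inhomogeneous term. *)
Lemma eigen_off x : x != c ->
  (deg off x)%:R * v x + \sum_(y | off x y) v y = (lam - 1) * v x - v c.
Proof.
move=> xc; have := veig x; rewrite /Qop deg_off // nbr_sum_off // -natr1 => h.
by rewrite mulrBl -h; ring.
Qed.

Lemma eigen_center :
  #|T|.-1%:R * v c + \sum_(x | x != c) v x = lam * v c.
Proof.
rewrite -veig /Qop; congr (_%:R * _ + _).
  rewrite /deg -(cardsC1 c) -cardsE; apply: eq_card => y; rewrite !inE.
  by have [->|yc] := eqVneq y c; [rewrite (proj2 g)|rewrite full].
by apply: eq_bigl => y; have [->|yc] := eqVneq y c; [rewrite (proj2 g)|rewrite full].
Qed.

Section OnPath.
Variable p : seq T.
Hypotheses (pc : path_comp off p) (pnc : c \notin p).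
Let u i := v (nth c p i).
Let k2 : (1 < size p)%N. Proof. by case: pc. Qed.

Lemma path_nc i : (i < size p)%N -> nth c p i != c.
Proof. by move=> ip; apply: contraNneq pnc => <-; rewrite mem_nth. Qed.

Lemma path_eq0 : u 0%N + u 1%N = (lam - 1) * u 0%N - v c.
Proof.
have p0 : (0 < size p)%N by lia.
have := eigen_off (path_nc p0).
by rewrite (path_nbr_sum c v pc p0) (path_deg c pc p0) k2 /= mul1r add0r.
Qed.

Lemma path_eqi i : (i.+2 < size p)%N ->
  2%:R * u i.+1 + u i + u i.+2 = (lam - 1) * u i.+1 - v c.
Proof.
move=> ip; have := eigen_off (path_nc (ltnW ip)).
by rewrite (path_nbr_sum c v pc (ltnW ip)) (path_deg c pc (ltnW ip)) ip /= addrA.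
Qed.

Lemma path_eql : u (size p).-1 + u (size p).-2 = (lam - 1) * u (size p).-1 - v c.
Proof.
have p0 : ((size p).-1 < size p)%N by lia.
have := eigen_off (path_nc p0).
rewrite (path_nbr_sum c v pc p0) (path_deg c pc p0).
have -> : (0 < (size p).-1)%N by lia.
have -> : ((size p).-1.+1 < size p)%N = false by lia.
by rewrite /= mul1r addr0.
Qed.

Lemma path_sumE : \sum_(x <- p) v x = \sum_(i < size p) u i.
Proof. by rewrite (big_nth c) big_mkord. Qed.

End OnPath.

Section Mode.
Variable r : C.
Hypotheses (r0 : r != 0) (r1 : r != 1) (lamE : lam = 3%:R + r + r^-1) (vc0 : v c = 0).

Let lam1 : lam - 1 = 2%:R + r + r^-1.
Proof. by rewrite lamE; ring. Qed.

Lemma path_mode_period p : path_comp off p -> c \notin p -> r != -1 ->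
  v (nth c p 0) != 0 -> r ^+ (2 * size p) = 1.
Proof.
move=> pc pnc rN1 v0; have [k2 _ _] := pc.
have h0 := path_eq0 pc pnc; have hi := path_eqi pc pnc; have hl := path_eql pc pnc.
rewrite vc0 lam1 !subr0 in h0 hl.
have hi' i : (i.+2 < size p)%N ->
    2%:R * v (nth c p i.+1) + v (nth c p i) + v (nth c p i.+2) =
    (2%:R + r + r^-1) * v (nth c p i.+1).
  by move=> ik; rewrite hi // vc0 lam1 subr0.
exact: (@path_seq_period _ (fun i => v (nth c p i))).
Qed.

Lemma path_mode_sum p : path_comp off p -> c \notin p ->
  r ^+ size p * (r - 1) ^+ 2 * (\sum_(x <- p) v x) =
  r * v (nth c p 0) * (r ^+ size p - 1) ^+ 2.
Proof.
move=> pc pnc; have [k2 _ _] := pc; rewrite path_sumE.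
have h0 := path_eq0 pc pnc; have hi := path_eqi pc pnc; rewrite vc0 lam1 subr0 in h0.
apply: (@path_seq_sum _ (fun i => v (nth c p i)) (size p)) => // i ik.
by rewrite hi // vc0 lam1 subr0.
Qed.

(** The closed form makes the head value determine the whole path. The case r = -1 is included;
    there the eigenvalue is 1. *)
Lemma path_mode0 p x : path_comp off p -> c \notin p -> v (nth c p 0) = 0 ->
  x \in p -> v x = 0.
Proof.
move=> pc pnc v0 xp; have [k2 _ _] := pc.
have h0 := path_eq0 pc pnc; have hi := path_eqi pc pnc; rewrite vc0 lam1 subr0 in h0.
have ip : (index x p < size p)%N by rewrite index_mem.
have := @path_seqE _ (fun i => v (nth c p i)) (size p) r r0 h0 _ _ ip.
rewrite nth_index // v0 mul0r => h.
have /eqP : r ^+ index x p * (r - 1) * v x = 0.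
  by apply: h => i ik; rewrite hi // vc0 lam1 subr0.
by rewrite !mulf_eq0 expf_eq0 (negPf r0) andbF subr_eq0 (negPf r1) /= => /eqP.
Qed.

Lemma cycle_mode0 p x : cycle_comp off p -> c \notin p -> r ^+ size p != 1 ->
  x \in p -> v x = 0.
Proof.
move=> pc pnc rp xp; have [k3 _ _] := pc; have k0 : (0 < size p)%N by lia.
have ip : (index x p < size p)%N by rewrite index_mem.
rewrite -(nth_index c xp) -(modn_small ip).
(* The values around the cycle are extended periodically to all indices. *)
apply: (@cycle_seq0 _ (fun i => v (nth c p (i %% size p))) (size p) r) => // i.
  by rewrite modnDr.
have ii : (i.+1 %% size p < size p)%N by rewrite ltn_pmod.
have nc : nth c p (i.+1 %% size p) != c.
  by apply: contraNneq pnc => <-; rewrite mem_nth.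
have := eigen_off nc; rewrite (cycle_nbr_sum c v pc ii) (cycle_deg c pc ii).
have -> : ((i.+1 %% size p).+1 %% size p = i.+2 %% size p)%N.
  by rewrite -addn1 modnDml addn1.
have -> : ((i.+1 %% size p + size p).-1 %% size p = i %% size p)%N.
  have -> : ((i.+1 %% size p + size p).-1 = i.+1 %% size p + (size p).-1)%N.
    by move: (i.+1 %% _)%N => m; case: (size p) k0 => // n _; rewrite addnS.
  by rewrite modnDml addSn -addnS prednK // modnDr.
by rewrite vc0 subr0 lam1 => <-; ring.
Qed.

End Mode.

(** The pair sums alternate between -(v c) and 0: odd length would force [v c] to vanish, and an
    even path splits into pairs of sum -(v c). *)
Lemma path_one_even p : lam = 1 -> path_comp off p -> c \notin p ->
  v c != 0 -> ~~ odd (size p) /\ 2%:R * (\sum_(x <- p) v x) = - (size p)%:R * v c.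
Proof.
move=> l1 pc pnc vc; have [k2 _ _] := pc.
have h0 := path_eq0 pc pnc; have hi := path_eqi pc pnc; have hl := path_eql pc pnc.
rewrite l1 subrr !mul0r !add0r in h0 hl.
have hi' i : (i.+2 < size p)%N ->
    2%:R * v (nth c p i.+1) + v (nth c p i) + v (nth c p i.+2) = - v c.
  by move=> ik; rewrite hi // l1 subrr mul0r add0r.
have ev : ~~ odd (size p).
  apply: contra vc => od; apply/eqP.
  exact: (@path_one_odd _ (fun i => v (nth c p i)) (size p) (v c)).
split=> //; rewrite path_sumE.
have ek : (size p = (size p)./2.*2)%N by rewrite halfK (negPf ev) subn0.
rewrite ek; set j := _./2; rewrite (@path_one_sum _ (fun i => v (nth c p i)) (size p) (v c)) //.
  by rewrite -muln2 natrM; ring.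
by rewrite /j -ek.
Qed.

End Eigen.

(* Pairing an eigenfunction that vanishes at the centre, cut down to one
   component, with an arbitrary eigenfunction for the same eigenvalue. *)
Lemma fredholm (v w : T -> C) lam p : (forall x, Qop e v x = lam * v x) ->
  (forall x, Qop e w x = lam * w x) -> v c = 0 -> path_comp off p -> c \notin p ->
  (\sum_(x <- p) v x) * w c = 0.
Proof.
move=> hv hw vc0 pc pnc; have [_ up _] := pc; rewrite (big_uniq _ up) /=.
have nc x : x \in p -> x != c by move=> xp; apply: contraNneq pnc => <-.
have cl x y : off x y -> (x \in p) = (y \in p).
  move=> oxy; apply/idP/idP => h; first exact: (path_comp_closed pc h).
  by apply: (path_comp_closed pc h); rewrite off_sym.
(* The adjacency form of the component. It is symmetric because [p] is closed, so evaluating it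
   through either eigenvalue equation leaves only the term from the centre. *)
pose B (a b : T -> C) := \sum_(x in p) \sum_(y | off x y) a x * b y.
have Bsym : B v w = B w v.
  have BE a b : B a b = \sum_x \sum_y (if off x y && (x \in p) then a x * b y else 0).
    rewrite /B big_mkcond; apply: eq_bigr => x _; case: ifP => xp; last first.
      by rewrite big1 // => y _; rewrite andbF.
    by rewrite big_mkcond; apply: eq_bigr => y _; rewrite andbT.
  rewrite !BE exchange_big; apply: eq_bigr => x _; apply: eq_bigr => y _.
  rewrite off_sym mulrC; case oxy : (off x y) => //=.
  by rewrite (cl _ _ oxy).
have key a b : (forall x, Qop e b x = lam * b x) ->
    B a b = \sum_(x in p) a x * ((lam - 1) * b x - (deg off x)%:R * b x)
            - (\sum_(x in p) a x) * b c.
  move=> hb; rewrite mulr_suml -sumrB; apply: eq_bigr => x xp.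
  rewrite -mulr_sumr -mulrBr; congr (_ * _).
  have := eigen_off hb (nc x xp) => h; rewrite addrAC -h; ring.
have := key v w hw; rewrite Bsym (key w v hv) vc0 mulr0 subr0 => h.
have E : \sum_(x in p) w x * ((lam - 1) * v x - (deg off x)%:R * v x) =
  \sum_(x in p) v x * ((lam - 1) * w x - (deg off x)%:R * w x).
  by apply: eq_bigr => x _; ring.
by move: h; rewrite E -{1}[X in X = _]addr0 => /addrI/esym/eqP; rewrite oppr_eq0 => /eqP.
Qed.

End Core.

(** * The spanning cycle *)

Lemma dvdn_eq_small k s : (s %| k)%N -> (0 < k)%N -> (k < 2 * s)%N -> k = s.
Proof.
case/dvdnP=> -[|[|t]] ->; rewrite ?mul1n // => _.
by rewrite ltnNge leq_mul2r orbT.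
Qed.

Lemma mul_sqN2_eq0 (F : numFieldType) (r x : F) :
  r != 0 -> r * x * (-1 - 1) ^+ 2 = 0 -> x = 0.
Proof.
move=> r0 /eqP; rewrite mulf_eq0 expf_eq0 /= -opprD oppr_eq0 -(mulr2n 1) pnatr_eq0 orbF.
by rewrite mulf_eq0 (negPf r0) => /eqP.
Qed.

Section Decomposition.
Variables (C : numClosedFieldType) (T : finType) (e : rel T) (c : T) (q s : nat).
Hypotheses (g : simple_graph e) (full : forall x, x != c -> e c x).
Hypothesis cT : #|T| = (s + 2 * q).+1.
Hypothesis degS : (\sum_(x | x != c) deg e x = 3 * s + 4 * q)%N.
Variables ps cs : seq (seq T).
Hypotheses (psP : forall p : seq T, p \in ps -> path_comp (off e c) p).
Hypotheses (csP : forall p : seq T, p \in cs -> cycle_comp (off e c) p).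
Hypothesis cover : perm_eq (flatten (ps ++ cs)) (enum [set~ c]).

Lemma flatten_uniq : uniq (flatten (ps ++ cs)).
Proof. by rewrite (perm_uniq cover) enum_uniq. Qed.

Lemma mem_cover x : (x \in flatten (ps ++ cs)) = (x != c).
Proof. by rewrite (perm_mem cover) mem_enum !inE. Qed.

Lemma comp_nc (p : seq T) : p \in ps ++ cs -> c \notin p.
Proof.
move=> pin; apply/negP=> cp; have : c \in flatten (ps ++ cs) by apply/flattenP; exists p.
by rewrite mem_cover eqxx.
Qed.

Lemma path_ncc (p : seq T) : p \in ps -> c \notin p.
Proof. by move=> pin; apply: comp_nc; rewrite mem_cat pin. Qed.

Lemma cycle_ncc (p : seq T) : p \in cs -> c \notin p.
Proof. by move=> pin; apply: comp_nc; rewrite mem_cat pin orbT. Qed.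

Lemma sum_cover (R : nmodType) (F : T -> R) :
  \sum_(x | x != c) F x =
  \sum_(p <- ps) \sum_(x <- p) F x + \sum_(p <- cs) \sum_(x <- p) F x.
Proof.
transitivity (\sum_(x <- flatten (ps ++ cs)) F x).
  by rewrite (perm_big _ cover) big_enum; apply: eq_bigl => x; rewrite !inE.
by rewrite big_flatten big_cat.
Qed.

Lemma sum_cover_nat (F : T -> nat) :
  (\sum_(x | x != c) F x =
  \sum_(p <- ps) \sum_(x <- p) F x + \sum_(p <- cs) \sum_(x <- p) F x)%N.
Proof. exact: (@sum_cover nat). Qed.

Lemma size_cover : (\sum_(p <- ps) size p + \sum_(p <- cs) size p = s + 2 * q)%N.
Proof.
have := sum_cover_nat (fun=> 1%N); under [X in _ = (X + _)%N]eq_bigr do rewrite sum1_size.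
under [X in _ = (_ + X)%N]eq_bigr do rewrite sum1_size.
move=> <-; have := cardsC1 c; rewrite cT /= => <-; rewrite sum1_card -cardsE.
by apply: eq_card => x; rewrite !inE.
Qed.

(** In [e], a path on k vertices has degree sum 3k - 2 and a cycle 3k; the prescribed total then
    fixes the number of paths. *)
Lemma size_paths : size ps = q.
Proof.
have h1 : (\sum_(p <- ps) \sum_(x <- p) deg e x + 2 * size ps = \sum_(p <- ps) 3 * size p)%N.
  rewrite -(sum1_size ps) big_distrr -big_split /=; apply: eq_big_seq => p pin.
  have pc := psP pin; have [k2 _ _] := pc; have nc := path_ncc pin.
  transitivity (\sum_(x <- p) (deg (off e c) x + 1) + 2)%N.
    congr (_ + _)%N; apply: eq_big_seq => x xp; rewrite (deg_off g full) ?addn1 //.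
    by apply: contraNneq nc => <-.
  by rewrite big_split /= (path_deg_sum c pc) sum1_size; lia.
have h2 : (\sum_(p <- cs) \sum_(x <- p) deg e x = \sum_(p <- cs) 3 * size p)%N.
  apply: eq_big_seq => p pin; have pc := csP pin; have nc := cycle_ncc pin.
  transitivity (\sum_(x <- p) (deg (off e c) x + 1))%N.
    apply: eq_big_seq => x xp; rewrite (deg_off g full) ?addn1 //.
    by apply: contraNneq nc => <-.
  by rewrite big_split /= (cycle_deg_sum c pc) sum1_size; lia.
have := sum_cover_nat (deg e); rewrite degS h2; have := size_cover; move: h1.
by rewrite -!big_distrr /=; lia.
Qed.

(** Two vertices from each of the q paths account for 2q of the s + 2q vertices. This budget
    controls all component sizes below. *)
Lemma excess : (\sum_(p <- ps) (size p - 2) + \sum_(p <- cs) size p = s)%N.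
Proof.
have : (\sum_(p <- ps) (size p - 2) + 2 * size ps = \sum_(p <- ps) size p)%N.
  rewrite -(sum1_size ps) big_distrr -big_split /=; apply: eq_big_seq => p pin.
  by have [k2 _ _] := psP pin; lia.
by have := size_cover; rewrite size_paths; lia.
Qed.

Lemma uniq_paths : uniq ps.
Proof.
apply: flatten_uniq_uniq; last by apply/negP=> /psP[].
by have := flatten_uniq; rewrite flatten_cat cat_uniq => /and3P[].
Qed.

Lemma excess_le (l : seq (seq T)) : uniq l -> {subset l <= ps} ->
  (\sum_(p <- l) (size p - 2) + \sum_(p <- cs) size p <= s)%N.
Proof.
move=> ul ls; rewrite -[X in (_ <= X)%N]excess leq_add2r.
exact: sum_subseq_le.
Qed.

Lemma cycle_size_le (p : seq T) : p \in cs -> (size p <= \sum_(p <- cs) size p)%N.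
Proof. by move=> pin; rewrite (big_rem p) //= leq_addr. Qed.

Lemma eigen_all0 (v : T -> C) : v c = 0 ->
  (forall (p : seq T) x, p \in ps -> x \in p -> v x = 0) ->
  (forall (p : seq T) x, p \in cs -> x \in p -> v x = 0) -> forall x, v x = 0.
Proof.
move=> vc hp hc x; have [->//|xc] := eqVneq x c.
move: xc; rewrite -mem_cover => /flattenP[p]; rewrite mem_cat => /orP[] pin xp.
  exact: (hp p).
exact: (hc p).
Qed.

Section Argument.
Hypothesis s3 : (2 < s)%N.
Hypothesis one_cycle : (size cs <= 1)%N.
Hypothesis large : (2 < s + 2 * q)%N.
Variable r : C.
Hypothesis prim : s.-primitive_root r.
(** Multiplicities enter as the freedom to prescribe zeros: one vertex for multiplicity 2, fewer
    than q vertices for multiplicity q, and up to q vertices for q + 1. *)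
Hypothesis eigR : forall x0, exists v : T -> C, [/\ exists x, v x != 0,
  forall x, Qop e v x = (3%:R + r + r^-1) * v x & v x0 = 0].
Hypothesis eig1 : forall S : seq T, (size S < q)%N -> exists v : T -> C,
  [/\ exists x, v x != 0, forall x, Qop e v x = 1 * v x & forall x, x \in S -> v x = 0].
Hypothesis eig1even : ~~ odd s -> forall S : seq T, (size S <= q)%N -> exists v : T -> C,
  [/\ exists x, v x != 0, forall x, Qop e v x = 1 * v x & forall x, x \in S -> v x = 0].

Let r0 : r != 0.
Proof.
apply: contra_eq_neq (prim_expr_order prim) => ->.
by rewrite expr0n gtn_eqF ?(ltn_trans _ s3) // eq_sym oner_neq0.
Qed.
Let rX k : (r ^+ k == 1) = (s %| k)%N.
Proof. by rewrite (prim_order_dvd prim). Qed.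
Let r1 : r != 1.
Proof. by rewrite -[r]expr1 rX; apply/negP=> /dvdn_leq; lia. Qed.
Let r2 : r ^+ 2 != 1.
Proof. by rewrite rX; apply/negP=> /dvdn_leq; lia. Qed.
Let rN1 : r != -1.
Proof. by apply: contraNneq r2 => ->; rewrite sqrrN expr1n. Qed.
Let lamN1 : 1 = 3%:R + (-1) + (-1)^-1 :> C.
Proof. by rewrite invrN1; ring. Qed.
Let N10 : (-1) != 0 :> C.
Proof. by rewrite oppr_eq0 oner_eq0. Qed.
Let N11 : (-1) != 1 :> C.
Proof. by rewrite eq_sym -addr_eq0 -mulr2n pnatr_eq0. Qed.

Let hd (p : seq T) := nth c p 0.

Lemma sum_paths1 (p : seq T) (v : T -> C) : p \in ps ->
  (forall p' : seq T, p' \in rem p ps -> forall x, x \in p' -> v x = 0) ->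
  (forall p' : seq T, p' \in cs -> forall x, x \in p' -> v x = 0) ->
  \sum_(x | x != c) v x = \sum_(x <- p) v x.
Proof.
move=> pin hp hc; rewrite sum_cover (big_rem p) //= [X in _ + X + _]big1_seq.
  rewrite [X in _ + X]big1_seq ?addr0 // => p' /= p'in.
  by rewrite big1_seq // => x /= xp; apply: (hc p').
by move=> p' /= p'in; rewrite big1_seq // => x /= xp; apply: (hp p').
Qed.

(** Take an eigenfunction for 1 that vanishes at all path heads. If it vanished at the centre, it
    would vanish on the paths and on odd cycles, hence everywhere. Otherwise all paths are even, and
    by the parity of [excess] an only cycle would be even too. Without cycles, the equation at the
    centre forces s + 2q = 2. *)
Lemma even_cycle : ~~ odd s -> exists2 p : seq T, p \in cs & ~~ odd (size p).
Proof.
move=> se; apply/hasP; apply: contraT => /hasPn noeven.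
have [|v [[x vx] veig v0]] := eig1even se (S := map hd ps).
  by rewrite size_map size_paths.
have [vc0|vc] := eqVneq (v c) 0.
  case/negP: vx; apply/eqP; apply: eigen_all0 => // p y pin yp.
    apply: (path_mode0 g full veig N10 N11 lamN1 vc0 (psP pin) (path_ncc pin)) => //.
    exact/v0/(map_f hd).
  apply: (cycle_mode0 g full veig N10 N11 lamN1 vc0 (csP pin) (cycle_ncc pin)) => //.
  by have := noeven p pin; rewrite negbK -signr_odd => ->; rewrite expr1.
have pe (p : seq T) (pin : p \in ps) := path_one_even g full veig erefl (psP pin) (path_ncc pin) vc.
have ev : ~~ odd (\sum_(p <- ps) (size p - 2)).
  rewrite big_seq_cond; apply: (big_ind (fun n => ~~ odd n)) => //; first by move=> a b; rewrite oddD => /negPf-> /negPf->.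
  by move=> p /andP[pin _]; have [h _] := pe p pin; have [k2 _ _] := psP pin; rewrite oddB // addbF.
have cs0 : cs = [::].
  case: cs one_cycle noeven excess => // p [|//] _ noe ex.
  have := noe p (mem_head _ _); rewrite negbK => op.
  by move: se; rewrite -ex big_cons big_nil addn0 oddD op (negPf ev).
have := eigen_center g full veig; rewrite cT /= sum_cover cs0 big_nil addr0 mul1r.
move/(congr1 ( *%R 2%:R)); rewrite mulrDr mulr_sumr.
have -> : \sum_(p <- ps) 2%:R * (\sum_(x0 <- p) v x0) = - (s + 2 * q)%:R * v c.
  rewrite -size_cover cs0 big_nil addn0 natr_sum -sumrN mulr_suml.
  by apply: eq_big_seq => p pin; case: (pe p pin).
move/eqP; rewrite -subr_eq0.
have -> : 2%:R * ((s + 2 * q)%:R * v c) + - (s + 2 * q)%:R * v c - 2%:R * v c =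
    ((s + 2 * q)%:R - 2%:R) * v c by ring.
rewrite mulf_eq0 (negPf vc) orbF subr_eq0 eqr_nat.
by move: large; clear; lia.
Qed.

Lemma spanning_cycle : exists2 p : seq T, p \in cs & size p = s.
Proof.
have [/hasP[p pin /eqP ps_]|/hasPn nos] := boolP (has (fun p : seq T => size p == s) cs); first by exists p.
(* Every cycle has at most [s] vertices by [excess], and here fewer, so [s] does not divide its
   length. *)
have cyc0 v : (forall x, Qop e v x = (3%:R + r + r^-1) * v x) -> v c = 0 ->
    forall p : seq T, p \in cs -> forall x, x \in p -> v x = 0.
  move=> veig vc p pin x xp.
  apply: (cycle_mode0 g full veig r0 r1 erefl vc (csP pin) (cycle_ncc pin)) => //.
  rewrite rX; apply/negP=> /dvdn_leq; have [k3 _ _] := csP pin; have /= := nos p pin.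
  by move: k3 excess (cycle_size_le pin); clear; lia.
have [v [[x vx] veig vc]] := eigR c.
have [p0 p0in hp0] : exists2 p0 : seq T, p0 \in ps & v (hd p0) != 0.
  apply/hasP; apply: contraT => /hasPn no; case/negP: vx; apply/eqP.
  apply: eigen_all0 => // p y pin yp; last exact: (cyc0 v veig vc p).
  apply: (path_mode0 g full veig r0 r1 erefl vc (psP pin) (path_ncc pin)) => //.
  by have := no p pin; rewrite negbK => /eqP.
have perk w (p : seq T) : (forall x, Qop e w x = (3%:R + r + r^-1) * w x) -> w c = 0 ->
    p \in ps -> w (hd p) != 0 -> (s %| 2 * size p)%N.
  move=> weig wc pin wp; rewrite -rX; apply/eqP.
  exact: (path_mode_period g full weig r0 r1 erefl wc (psP pin) (path_ncc pin) rN1).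
have k0d := perk v p0 veig vc p0in hp0.
have [k2 _ _] := psP p0in.
have k0le := @excess_le [:: p0] isT; rewrite big_seq1 in k0le.
have {}k0le : (size p0 - 2 + \sum_(p <- cs) size p <= s)%N.
  by apply: k0le => p; rewrite inE => /eqP->.
(* Odd case: [s] divides the size of [p0], which is at most s + 2 < 2s. A path on [s] vertices
   leaves an excess of 2, too small for a cycle. *)
have [so|se] := boolP (odd s).
  have k0s : size p0 = s.
    move: k0d; rewrite Gauss_dvdr ?coprimen2 // => k0d.
    by apply: dvdn_eq_small k0d (ltnW k2) _; move: k0le s3; clear; lia.
  have cs0 : cs = [::].
    case E : cs => [|p l] //; have pin : p \in cs by rewrite E mem_head.
    have [k3 _ _] := csP pin; exfalso.
    by move: k3 (cycle_size_le pin) k0le k0s; clear; lia.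
  (* This eigenfunction for 1 vanishes at the heads of the other q - 1 paths. The odd path [p0]
     makes it vanish at the centre; then the equation at the centre and [path_mode_sum] at r = -1
     kill it on [p0] too. *)
  have [|w [[y wy] weig w0]] := eig1 (S := map hd (rem p0 ps)).
    by rewrite size_map size_rem // size_paths prednK // -size_paths; case: ps p0in.
  have wc : w c = 0.
    apply/eqP; apply: contraT => wc.
    by have [] := path_one_even g full weig erefl (psP p0in) (path_ncc p0in) wc; rewrite k0s so.
  have wrest (p' : seq T) : p' \in rem p0 ps -> forall x, x \in p' -> w x = 0.
    move=> pin z zp; have pin' := mem_rem pin.
    apply: (path_mode0 g full weig N10 N11 lamN1 wc (psP pin') (path_ncc pin')) => //.
    exact/w0/(map_f hd).
  have := eigen_center g full weig; rewrite wc !mulr0 add0r (sum_paths1 p0in wrest); last by rewrite cs0.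
  move=> sum0; have := path_mode_sum g full weig N10 lamN1 wc (psP p0in) (path_ncc p0in).
  rewrite sum0 mulr0 k0s -signr_odd so expr1 => /esym/(mul_sqN2_eq0 N10) wh.
  case/negP: wy; apply/eqP; apply: eigen_all0 => // p z pin zp; last by rewrite cs0 in pin.
  have [ep|ne] := eqVneq p p0; last by apply: (wrest p) => //; apply: mem_rem_neq.
  apply: (path_mode0 g full weig N10 N11 lamN1 wc (psP pin) (path_ncc pin)) => //.
  by rewrite ep.
have [c0 c0in c0e] := even_cycle se; have [c03 _ _] := csP c0in.
have c0le := cycle_size_le c0in; have /= c0s := nos c0 c0in.
(* The even cycle takes at least 3 from the budget, so the path has fewer than [s] vertices and
   twice its size is less than 2s. *)
have half (p : seq T) : p \in ps -> (s %| 2 * size p)%N -> (2 * size p)%N = s.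
  move=> pin kd; have [kp _ _] := psP pin.
  have := @excess_le [:: p] isT; rewrite big_seq1 => kle.
  have {}kle : (size p - 2 + \sum_(p <- cs) size p <= s)%N.
    by apply: kle => p'; rewrite inE => /eqP->.
  by apply: dvdn_eq_small kd _ _; move: kle kp c0le c03; clear; lia.
have rhalf (p : seq T) : (2 * size p)%N = s -> r ^+ size p = -1.
  move=> ks; have : r ^+ size p ^+ 2 == 1 by rewrite -exprM mulnC ks rX.
  rewrite sqrf_eq1 => /orP[|/eqP//]; rewrite rX => /dvdn_leq h; exfalso.
  by move: h ks s3; clear; lia.
(* On a half-length path r^k = -1, and [path_mode_sum] has the nonzero factor (-2)^2. *)
have sumn0 w (p : seq T) : (forall x, Qop e w x = (3%:R + r + r^-1) * w x) -> w c = 0 ->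
    p \in ps -> w (hd p) != 0 -> \sum_(x <- p) w x != 0.
  move=> weig wc pin wp; have := path_mode_sum g full weig r0 erefl wc (psP pin) (path_ncc pin).
  rewrite (rhalf p (half p pin (perk w p weig wc pin wp))) => h.
  by apply: contraNneq wp => s0; move: h; rewrite s0 mulr0 => /esym/(mul_sqN2_eq0 r0)/eqP.
(* A second eigenfunction, chosen to vanish at the head of [p0]. Pairing it with [v] on [p0], where
   [v] has nonzero sum, makes it vanish at the centre. *)
have [w [[y wy] weig wh]] := eigR (hd p0).
have wc : w c = 0.
  have /eqP := fredholm g full veig weig vc (psP p0in) (path_ncc p0in).
  by rewrite mulf_eq0 (negPf (sumn0 v p0 veig vc p0in hp0)) => /eqP.
have [p1 p1in hp1] : exists2 p1 : seq T, p1 \in ps & w (hd p1) != 0.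
  apply/hasP; apply: contraT => /hasPn no; case/negP: wy; apply/eqP.
  apply: eigen_all0 => // p z pin zp; last exact: (cyc0 w weig wc p).
  apply: (path_mode0 g full weig r0 r1 erefl wc (psP pin) (path_ncc pin)) => //.
  by have := no p pin; rewrite negbK => /eqP.
have p10 : p1 != p0 by apply: contraNneq hp1 => ->; rewrite wh.
(* A third path of size s/2 would give 3(s/2 - 2) + |c0| <= s, hence s/2 + |c0| <= 6. This is
   impossible for an even cycle [c0] with 4 <= |c0| < s. *)
have wrest (p' : seq T) : p' \in rem p1 ps -> forall x, x \in p' -> w x = 0.
  rewrite mem_rem_uniq ?uniq_paths // !inE => /andP[np pin] z zp.
  apply: (path_mode0 g full weig r0 r1 erefl wc (psP pin) (path_ncc pin)) => //.
  apply/eqP; apply: contraT => hp2.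
  have p20 : p' != p0 by apply: contraNneq hp2 => ->; rewrite -/(hd p0) wh.
  have ul : uniq [:: p0; p1; p'].
    by rewrite /= !inE !negb_or !andbT [p0 == p1]eq_sym [p0 == p']eq_sym [p1 == p']eq_sym p10 p20 np.
  have := excess_le ul; rewrite !big_cons big_nil => h.
  have {}h : (size p0 - 2 + (size p1 - 2 + (size p' - 2 + 0)) + \sum_(p <- cs) size p <= s)%N.
    by apply: h => p''; rewrite !inE => /or3P[]/eqP->.
  have := half p0 p0in k0d; have := half p1 p1in (perk w p1 weig wc p1in hp1).
  have := half p' pin (perk w p' weig wc pin hp2).
  have : (3 < size c0)%N by move: c03 c0e; clear; lia.
  by move: h c0le c0s; clear; lia.
(* Only [p1] carries [w], so the equation at the centre makes its sum over [p1] zero, against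
   [sumn0]. *)
have := eigen_center g full weig; rewrite wc !mulr0 add0r (sum_paths1 p1in wrest (cyc0 w weig wc)).
by move/eqP; rewrite (negPf (sumn0 w p1 weig wc p1in hp1)).
Qed.

End Argument.
End Decomposition.

(** * At most one cycle, and the isomorphism with the target *)

Section Conclusion.
Variables (T : finType) (e : rel T) (c : T) (q s : nat).
Hypotheses (g : simple_graph e) (full : forall x, x != c -> e c x).
Hypotheses (cT : #|T| = (s + 2 * q).+1) (s3 : (2 < s)%N).
Variables ps cs : seq (seq T).
Hypotheses (psP : forall p : seq T, p \in ps -> path_comp (off e c) p).
Hypotheses (csP : forall p : seq T, p \in cs -> cycle_comp (off e c) p).
Hypothesis cover : perm_eq (flatten (ps ++ cs)) (enum [set~ c]).

Let offc := off_sym c g.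

(** A cycle vertex has degree 3 in [e] and two neighbours on its cycle, so the indicator of a cycle
    has Rayleigh quotient exactly 5. Two cycles have no edges between them, and [two_sets] applies
    to a zero form. *)
Lemma cycles_le1 (C : numClosedFieldType) (l : T -> C) :
  (forall z : T -> C, (exists x, z x != 0) ->
    \sum_x l x * z x = 0 -> Qform e z < 5%:R * sqnorm z) -> (size cs <= 1)%N.
Proof.
move=> Qlt5; rewrite leqNgt; apply/negP=> cs2.
pose a := nth [::] cs 0; pose b := nth [::] cs 1.
have ain : a \in cs by apply: mem_nth; apply: ltn_trans cs2.
have bin : b \in cs by apply: mem_nth.
have disj x : x \in a -> x \in b -> False.
  move=> xa xb; have := flatten_uniq cover; rewrite flatten_cat cat_uniq => /and3P[_ _ u].
  by have := flatten_uniq_inj u xa xb.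
have nbr p x : p \in cs -> x \in p -> (deg e x = 3) /\ nbrs_in e [set x in p] x = 2.
  move=> pin xp; have pc := csP pin; have pnc := cycle_ncc cover pin.
  have xc : x != c by apply: contraNneq pnc => <-.
  have d2 : deg (off e c) x = 2.
    by rewrite -(nth_index c xp); apply: cycle_deg; rewrite ?index_mem.
  split; first by rewrite (deg_off g full) // d2.
  rewrite /nbrs_in (@nbr_sum_off _ _ _ g full nat (fun y => (y \in [set x in p]) : nat) _ xc).
  rewrite inE (negPf pnc) -d2 degE; apply: eq_bigr => y oxy.
  by rewrite inE (cycle_comp_closed pc xp oxy).
have tot p : p \in cs ->
    (\sum_(x in [set x in p]) (deg e x + nbrs_in e [set x in p] x) = 5 * #|[set x in p]|)%N.
  move=> pin; rewrite -sum1_card big_distrr /=; apply: eq_bigr => x.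
  by rewrite inE => xp; have [-> ->] := nbr p x pin xp.
have ne p : p \in cs -> [set x in p] != set0.
  move=> pin; have [k3 _ _] := csP pin; case: p k3 pin => // x p _ _.
  by apply/set0Pn; exists x; rewrite inE mem_head.
apply: (two_sets g Qlt5 (P := [set x in a]) (R := [set x in b])).
- rewrite -setI_eq0; apply/eqP/setP=> x; rewrite !inE; apply/negP=> /andP[xa xb].
  exact: (disj x).
- exact: ne.
- exact: ne.
- by rewrite tot.
- by rewrite tot.
- rewrite !tot // subnn leqn0 expn_eq0 andbT sum_nat_eq0; apply/forallP=> x.
  apply/implyP; rewrite inE => xa; have pnc := cycle_ncc cover ain.
  have xc : x != c by apply: contraNneq pnc => <-.
  rewrite /nbrs_in (@nbr_sum_off _ _ _ g full nat (fun y => (y \in [set x in b]) : nat) _ xc).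
  rewrite inE (negPf (cycle_ncc cover bin)) big1 // => y oxy.
  rewrite inE; apply/eqP; rewrite eqb0; apply/negP; apply: (disj y).
  exact: cycle_comp_closed (csP ain) xa oxy.
Qed.

Lemma iso_Grel c0 : cs = [:: c0] -> size c0 = s -> size ps = q ->
  (forall p : seq T, p \in ps -> size p = 2) -> isomorphic (Grel q s) e.
Proof.
move=> csE c0s psq ps2.
have c0in : c0 \in cs by rewrite csE mem_head.
have pin (j : 'I_q) : nth [::] ps j \in ps by rewrite mem_nth // psq.
pose F (x : Gvert q s) : T := match x with
  | inl _ => c | inr (inl i) => nth c c0 i
  | inr (inr (j, b)) => nth c (nth [::] ps j) (nat_of_bool b) end.
have Fcyc (i : 'I_s) : nth c c0 i \in c0 by rewrite mem_nth // c0s.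
have Ftip (j : 'I_q) (b : bool) : nth c (nth [::] ps j) b \in nth [::] ps j.
  by rewrite mem_nth // ps2 //; case: b.
have ccyc (i : 'I_s) : nth c c0 i != c.
  by apply: contraNneq (cycle_ncc cover c0in) => <-.
have ctip (j : 'I_q) (b : bool) : nth c (nth [::] ps j) b != c.
  by apply: contraNneq (path_ncc cover (pin j)) => <-.
have u := flatten_uniq cover.
have up : uniq (flatten ps) by move: u; rewrite flatten_cat cat_uniq => /and3P[].
have dis x (j : 'I_q) : x \in c0 -> x \in nth [::] ps j -> False.
  move=> xc0 xj; move: u; rewrite flatten_cat cat_uniq => /and3P[_ /hasPn h _].
  have /h/negP[] : x \in flatten cs by apply/flattenP; exists c0.
  by apply/flattenP; exists (nth [::] ps j).
have [_ uc0 hc0] := csP c0in.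
have Finj : injective F.
  move=> [[]|[i|[j b]]] [[]|[i'|[j' b']]] //= E.
  - by have := ccyc i'; rewrite -E eqxx.
  - by have := ctip j' b'; rewrite -E eqxx.
  - by have := ccyc i; rewrite E eqxx.
  - by move/eqP: E; rewrite nth_uniq ?c0s // => /eqP/val_inj->.
  - by case: (@dis (nth c c0 i) j') => //; rewrite E.
  - by have := ctip j b; rewrite E eqxx.
  - by case: (@dis (nth c c0 i') j) => //; rewrite -E.
  - have ej : j = j'.
      apply: val_inj; apply: (@flatten_uniq_inj _ ps _ _ (nth c (nth [::] ps j) b) up) => //.
      by rewrite E.
    rewrite -ej in E *; congr (inr (inr (_, _))).
    have [_ upj _] := psP (pin j).
    by move/eqP: E; rewrite nth_uniq ?ps2 //; case: (b); case: (b').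
exists F; split; first by apply: inj_card_bij => //; rewrite (card_Gvert q s3) cT.
have eoff x y : x != c -> y != c -> e x y = off e c x y by move=> xc yc; rewrite /off xc yc !andbT.
move=> [[]|[i|[j b]]] [[]|[i'|[j' b']]] /=.
- by rewrite (proj2 g).
- by rewrite full.
- by rewrite full.
- by rewrite (proj1 g) full.
- rewrite eoff // hc0 ?c0s // !nth_uniq ?c0s ?ltn_pmod //; try lia.
  by rewrite cycle_relE.
- rewrite eoff //; apply/negP=> h; case: (@dis (nth c (nth [::] ps j') b') j') => //.
  exact: cycle_comp_closed (csP c0in) _ h.
- by rewrite (proj1 g) full.
- rewrite eoff // offc; apply/negP=> h; case: (@dis (nth c (nth [::] ps j) b) j) => //.
  exact: cycle_comp_closed (csP c0in) _ h.
- rewrite eoff // /copies_rel /K2_rel /=; have [ej|nj] := eqVneq j j'.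
    have [_ upj hp] := psP (pin j); rewrite -ej hp ?ps2 //; last by case: (b).
    by case: b; case: b' => /=; rewrite ?nth_uniq ?ps2 //= eqxx.
  apply/negP=> h; case/negP: nj; apply/eqP/val_inj.
  apply: (@flatten_uniq_inj _ ps _ _ (nth c (nth [::] ps j') b') up) => //.
  exact: path_comp_closed (psP (pin j)) _ h.
Qed.

End Conclusion.

Theorem theorem1p1 (q s : nat) :
  (3 <= s)%N -> (16 <= s + 2 * q + 1)%N ->
  forall (T : finType) (e : rel T), simple_graph e ->
  Q_cospectral (Grel q s) e -> isomorphic (Grel q s) e.
Proof.
move=> s3 n16 T e g cosp.
have gG := Grel_simple q s3.
have N15 : (15 <= s + 2 * q)%N by lia.
have cT : #|T| = (s + 2 * q).+1 by rewrite -(cospectral_card cosp) (card_Gvert q s3).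
have [Phi [Pnorm Pform Pn0 Plin]] := cospectral_isometry gG g cosp.
have Qge1 (z : T -> algC) : sqnorm z <= Qform e z.
  by rewrite -Pnorm -Pform; apply: Qform_Grel_ge.
have [l hl] := Plin (@Ghyper algC q s).
have Qlt5 (z : T -> algC) : (exists x, z x != 0) -> \sum_x l x * z x = 0 ->
    Qform e z < 5%:R * sqnorm z.
  move=> z0 lz; rewrite -Pnorm -Pform; apply: Qform_Grel_lt => //; first exact: Pn0.
  by rewrite hl.
have S1 := cospectral_deg gG g cosp; rewrite sum_deg_Grel // in S1.
have S2 := cospectral_deg2 gG g cosp; rewrite sum_deg2_Grel // in S2.
have [c [full d23 degS]] := degrees g Qge1 Qlt5 cT N15 (esym S1) (esym S2).
have dle x : (deg (off e c) x <= 2)%N.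
  have [->|xc] := eqVneq x c.
    by rewrite /deg eq_card0 // => y; rewrite !inE /off eqxx andbF.
  by have := d23 x xc; rewrite (deg_off g full xc); lia.
have [||ps [cs [psP csP cover]]] := components (off_sym c g) (off_irr c g) dle (S := [set~ c]).
- by move=> x y _ /and3P[_ _ yc]; rewrite !inE.
- by move=> x; rewrite !inE => xc; have := d23 x xc; rewrite (deg_off g full xc); lia.
have one := cycles_le1 g full csP cover Qlt5.
have [r prim] := C_prim_root_exists (ltnW (ltnW s3)).
have rX k : (r ^+ k == 1) = (s %| k)%N by rewrite (prim_order_dvd prim).
have r1 : r != 1 by rewrite -[r]expr1 rX; apply/negP=> /dvdn_leq; lia.
have r2 : r ^+ 2 != 1 by rewrite rX; apply/negP=> /dvdn_leq; lia.
have rs : r ^+ s = 1 := prim_expr_order prim.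
have r0 : r != 0.
  apply: contra_eq_neq rs => ->.
  by rewrite expr0n gtn_eqF ?(ltn_trans _ s3) // eq_sym oner_neq0.
have [p pin psz] : exists2 p : seq T, p \in cs & size p = s.
  apply: (spanning_cycle g full cT degS psP csP cover s3 one _ prim) => //; first by lia.
  (* The roots r and 1/r give the same eigenvalue and two independent modes. *)
  - move=> x0; have [||//|v [v0 veig vS]] :=
      @cospectral_eigen _ _ _ _ gG g cosp 2 (@cycle_modes algC q s r) (3%:R + r + r^-1) [:: x0].
    + move=> k x; rewrite /cycle_modes; case: eqP => _; first exact: cycle_mode_eigen.
      rewrite cycle_mode_eigen ?exprVn ?rs ?invr1 ?invr_eq1 // invrK; congr (_ * _); ring.
    + by move=> a; apply: cycle_modes_free.
    + by exists v; split=> //; apply: vS; rewrite mem_head.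
  - move=> S Sq; have [||//|v [v0 veig vS]] :=
      @cospectral_eigen _ _ _ _ gG g cosp q (@tip_mode algC q s) 1 S.
    + by move=> k x; rewrite mul1r; apply: tip_mode_eigen.
    + exact: tip_modes_free.
    + by exists v.
  - move=> se S Sq; have [||//|v [v0 veig vS]] :=
      @cospectral_eigen _ _ _ _ gG g cosp q.+1 (@even_modes algC q s) 1 S.
    + by move=> k x; rewrite mul1r; apply: even_modes_eigen.
    + by move=> a; apply: even_modes_free.
    + by exists v.
have psq := size_paths g full cT degS psP csP cover.
have csE : cs = [:: p] by move: one pin; clear; case: cs => [|c0 [|//]] //= _; rewrite inE => /eqP->.
apply: (iso_Grel g full cT s3 psP csP cover csE psz psq) => p' p'in.
have [k2 _ _] := psP p' p'in.
(* The spanning cycle uses up the whole budget [s], so every path has exactly two vertices. *)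
have := excess g full cT degS psP csP cover; rewrite csE big_seq1 psz (big_rem p') //=; lia.
Qed.
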